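(* Let $n\geq 2$ be an integer, let $a_0>0$ be real, and let $\mu$ be a real number with $0<\mu\leq\sqrt{\dfrac{2n-\pi}{n^2\pi}}<1$. If $p\in\mathcal{H}[a_0,n]$ satisfies $p(z)\neq 0$ for all $z\in\mathbb{U}$ and $$|\arg(p(z)-zp'(z))|<\arctan(n\mu)-\frac{\pi}{2}\mu\qquad\text{for all }z\in\mathbb{U},$$ then $p\in\mathcal{STH}[a_0,n](\mu)$, that is, $|\arg(p(z))|<\frac{\pi}{2}\mu$ for all $z\in\mathbb{U}$.
   Context: $\mathbb{U}=\{z\in\mathbb{C}:|z|<1\}$ is the open unit disk. For $a_0\in\mathbb{C}$ and a positive integer $n$, $\mathcal{H}[a_0,n]$ is the class of functions $p$ analytic in $\mathbb{U}$ of the form $p(z)=a_0+\sum_{k=n}^{\infty}a_kz^k$. For real $0<\mu\leq 1$, $\mathcal{STH}[a_0,n](\mu)$ is the class of $p\in\mathcal{H}[a_0,n]$ with $|\arg(p(z))|<\frac{\pi}{2}\mu$ for all $z\in\mathbb{U}$. Here $\arg$ denotes the principal argument, with values in $(-\pi,\pi]$; a condition on $\arg(w)$ includes that $w\neq0$. *)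

(* Defs.v *)
From Stdlib Require Import Reals Lra Lia.
From Coquelicot Require Import Coquelicot.
Open Scope R_scope.

Definition unit_disk (z : C) : Prop := Cmod z < 1.

(* Principal argument in (-PI, PI] of a nonzero complex number, characterised
   by Carg_bounds, Carg_polar and Carg_unique below; its value at 0 is junk. *)
Definition Carg (z : C) : R :=
  if Rle_dec 0 (Im z) then acos (Re z / Cmod z) else - acos (Re z / Cmod z).

Definition abs_arg_lt (w : C) (t : R) : Prop := w <> RtoC 0 /\ Rabs (Carg w) < t.

(* Complex differentiability: the scalar field of [ex_derive] is C. *)
Definition analytic_in_disk (p : C -> C) : Prop :=
  forall z : C, unit_disk z -> @ex_derive C_AbsRing C_NormedModule p z.

(* H[a0, n] *)
Definition classH (a0 : C) (n : nat) (p : C -> C) : Prop :=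
  analytic_in_disk p /\
  exists a : nat -> C,
    a 0%nat = a0 /\
    (forall k : nat, (0 < k < n)%nat -> a k = RtoC 0) /\
    (forall z : C, unit_disk z -> @is_pseries C_AbsRing C_NormedModule a z (p z)).

(* STH[a0, n](mu), for 0 < mu <= 1 *)
Definition classSTH (a0 : C) (n : nat) (mu : R) (p : C -> C) : Prop :=
  classH a0 n p /\
  forall z : C, unit_disk z -> abs_arg_lt (p z) (PI / 2 * mu).

Lemma Re_div_Cmod_bound (z : C) : z <> RtoC 0 -> -1 <= Re z / Cmod z <= 1.
Proof.
intros Hz.
assert (Hp : 0 < Cmod z) by (apply Cmod_gt_0; exact Hz).
pose proof (re_le_Cmod z) as H.
apply Rabs_le_between in H.
split.
- apply (Rmult_le_reg_r (Cmod z)); [lra|]. field_simplify; lra.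
- apply (Rmult_le_reg_r (Cmod z)); [lra|]. field_simplify; lra.
Qed.

Lemma Carg_bounds (z : C) : z <> RtoC 0 -> - PI < Carg z <= PI.
Proof.
intros Hz.
assert (Hp : 0 < Cmod z) by (apply Cmod_gt_0; exact Hz).
pose proof (acos_bound (Re z / Cmod z)) as H.
pose proof PI_RGT_0.
unfold Carg; destruct (Rle_dec 0 (Im z)) as [h|h]; [lra|].
split; [|lra].
destruct (Req_dec (acos (Re z / Cmod z)) PI) as [e|e]; [|lra].
exfalso.
pose proof (cos_acos _ (Re_div_Cmod_bound z Hz)) as Hc.
rewrite e, cos_PI in Hc.
assert (Hr : Re z = - Cmod z).
{ replace (Re z) with (Re z / Cmod z * Cmod z) by (field; lra).
  rewrite <- Hc; ring. }
pose proof (Cmod2_alt z) as H2.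
rewrite Hr in H2.
assert (Im z ^ 2 = 0) by (simpl in *; lra).
simpl in *; nra.
Qed.

Lemma Carg_polar (z : C) : z <> RtoC 0 ->
  z = (RtoC (Cmod z) * (cos (Carg z), sin (Carg z)))%C.
Proof.
intros Hz.
assert (Hp : 0 < Cmod z) by (apply Cmod_gt_0; exact Hz).
pose proof (Re_div_Cmod_bound z Hz) as Hb.
assert (Hs : sqrt (1 - (Re z / Cmod z)²) = Rabs (Im z) / Cmod z).
{ rewrite <- (sqrt_Rsqr (Rabs (Im z) / Cmod z)).
  2:{ apply Rdiv_le_0_compat; [apply Rabs_pos|lra]. }
  f_equal.
  pose proof (Cmod2_alt z) as H2.
  rewrite !Rsqr_div', <- Rsqr_abs.
  unfold Rsqr.
  apply (Rmult_eq_reg_r (Cmod z * Cmod z)); [|nra].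
  field_simplify; [|lra|lra].
  simpl in *; lra. }
assert (Hcos : cos (Carg z) = Re z / Cmod z).
{ unfold Carg; destruct (Rle_dec 0 (Im z)); rewrite ?cos_neg;
    apply cos_acos; exact Hb. }
assert (Hsin : sin (Carg z) = Im z / Cmod z).
{ unfold Carg; destruct (Rle_dec 0 (Im z)) as [h|h];
    rewrite ?sin_neg, sin_acos, Hs by exact Hb.
  - rewrite Rabs_pos_eq by exact h; reflexivity.
  - rewrite Rabs_left by lra; field; lra. }
rewrite Hcos, Hsin.
rewrite (surjective_pairing z) at 1.
unfold Cmult, RtoC, Re, Im; simpl.
f_equal; field; lra.
Qed.

Lemma Carg_unique (r t : R) : 0 < r -> - PI < t <= PI ->
  Carg (RtoC r * (cos t, sin t))%C = t.
Proof.
intros Hr Ht.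
set (z := (RtoC r * (cos t, sin t))%C).
assert (HRe : Re z = r * cos t) by (unfold z, Re; simpl; ring).
assert (HIm : Im z = r * sin t) by (unfold z, Im; simpl; ring).
assert (Hm : Cmod z = r).
{ unfold z; rewrite Cmod_mult, Cmod_R, Rabs_pos_eq by lra.
  unfold Cmod; simpl.
  replace (cos t * (cos t * 1) + sin t * (sin t * 1)) with 1.
  - rewrite sqrt_1; ring.
  - pose proof (sin2_cos2 t); unfold Rsqr in *; lra. }
unfold Carg; rewrite HRe, HIm, Hm.
replace (r * cos t / r) with (cos t) by (field; lra).
destruct (Rle_dec 0 (r * sin t)) as [h|h].
- apply acos_cos; split; [|lra].
  destruct (Rle_lt_dec 0 t) as [h'|h']; [exact h'|exfalso].
  pose proof (sin_gt_0 (- t)) as Hsn; rewrite sin_neg in Hsn; nra.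
- rewrite <- cos_neg, acos_cos; [lra|].
  split; [|lra].
  destruct (Rle_lt_dec t 0) as [h'|h']; [lra|exfalso].
  pose proof (sin_ge_0 t); nra.
Qed.

(* Main.v *)
Require Import Defs.
From Stdlib Require Import Reals Lra Lia Classical ClassicalEpsilon IndefiniteDescription.
From Coquelicot Require Import Coquelicot.
Open Scope R_scope.

(** Suppose p leaves the sector |arg| < mu PI/2, and let z0 be a point of least
    modulus where it does. On |z| < |z0| the function
    w = tanh (log (p / a0) / (2 mu)) is bounded by 1 and is O(z^n) at 0, so
    Schwarz's lemma gives |w| <= (|z| / |z0|)^n, that is
    |arg p(z)| <= 2 mu arctan ((|z| / |z0|)^n), with equality at z0. Comparing
    derivatives at z0 in all inward directions gives z0 p'(z0) / p(z0) = i b, where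
    |b| >= n mu and b has the sign of arg p(z0). Hence p - z p' = p (1 - i b) has
    argument at least arctan (n mu) - mu PI/2 in modulus at z0, a contradiction.

    Schwarz's lemma rests on a maximum principle without integration: for f
    with a second-order complex Taylor expansion at z, averaging
    |f|^2 + eps |u|^2 over the four points u = z + i^j t exceeds the value at z
    by at least eps t^2 - O(t^3). *)

(** * Complex Taylor expansions *)

(** Analyticity enters only through [jet], iterated divided differences: power series provide them,
    and products, composites and inverses keep them. Order 3 is what the four-point average
    consumes, a quadratic polynomial plus an O(t^3) error that the gain eps t^2 beats.

    The function w comes from conformal maps: s = log (p / a0) / mu turns the sector into the strip
    |Im s| < PI/2, and tanh (s / 2) maps this strip to the unit disk, sending 0 to 0. On |w| <= r
    the largest |Im s| is 2 arctan r, hence the bound 2 mu arctan (x^n) with x = |z| / |z0|. At x =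
    1 it equals mu PI/2, the half-angle of the sector, and its derivative there is n mu, the
    constant of the theorem.

    The radial direction alone bounds the imaginary part of z0 p'(z0) / p(z0); the oblique ones
    force its real part to vanish. Then arg (1 - i b) = - arctan b opposes arg p(z0), which is why
    the two angles subtract. As mu < 1, the sector lies in the right half-plane, where argument and
    logarithm are given by [atan]; p having no zero rules out contact at the vertex. *)

Definition near (z : C) (P : C -> Prop) : Prop :=
  exists d, 0 < d /\ forall u, Cmod (u - z) < d -> P u.

Lemma near_and (z : C) (P Q : C -> Prop) :
  near z P -> near z Q -> near z (fun u => P u /\ Q u).
Proof.
intros [d [hd hP]] [e [he hQ]].
exists (Rmin d e); split; [now apply Rmin_pos|].
intros u hu; split.
- apply hP; apply Rlt_le_trans with (1 := hu), Rmin_l.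
- apply hQ; apply Rlt_le_trans with (1 := hu), Rmin_r.
Qed.

Lemma near_imp (z : C) (P Q : C -> Prop) :
  (forall u, P u -> Q u) -> near z P -> near z Q.
Proof. intros H [d [hd hP]]; exists d; split; auto. Qed.

Lemma near_ball (z : C) (d : R) : 0 < d -> near z (fun u => Cmod (u - z) < d).
Proof. intros hd; exists d; auto. Qed.

Lemma near_self (z : C) (P : C -> Prop) : near z P -> P z.
Proof.
intros [d [hd hP]]; apply hP.
replace (z - z)%C with (RtoC 0) by ring; now rewrite Cmod_0.
Qed.

(** The growth estimate alone fixes the value at the origin, since its right-hand side is 0 at u = 0
    when n > 0. It serves for p and for w. *)
Lemma order_bound_at_0 (f : C -> C) (c : C) (M : R) (n : nat) : (0 < n)%nat ->
  near (RtoC 0) (fun u => Cmod (f u - c) <= M * Cmod u ^ n) -> f (RtoC 0) = c.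
Proof.
intros hn h; apply near_self in h.
rewrite Cmod_0, pow_i, Rmult_0_r in h by exact hn.
assert (e : (f (RtoC 0) - c)%C = RtoC 0).
{ apply Cmod_eq_0, Rle_antisym; [exact h|apply Cmod_ge_0]. }
replace (f (RtoC 0)) with (f (RtoC 0) - c + c)%C by ring; rewrite e; ring.
Qed.

Definition cont_at (f : C -> C) (z : C) : Prop :=
  forall e, 0 < e -> near z (fun u => Cmod (f u - f z) < e).

Lemma near_comp (f : C -> C) (z : C) (P : C -> Prop) :
  cont_at f z -> near (f z) P -> near z (fun u => P (f u)).
Proof.
intros hf [d [hd hP]]; apply near_imp with (2 := hf d hd); auto.
Qed.

(* [jet k f z]: f has an expansion with k coefficients and a remainder
   O((u - z)^k) at z, phrased by iterated divided differences. *)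
Fixpoint jet (k : nat) (f : C -> C) (z : C) : Prop :=
  match k with
  | O => exists K, near z (fun u => Cmod (f u) <= K)
  | S k => exists q, jet k q z /\ near z (fun u => f u = (f z + (u - z) * q u)%C)
  end.

Lemma jet_ext (k : nat) (f g : C -> C) (z : C) :
  near z (fun u => f u = g u) -> jet k f z -> jet k g z.
Proof.
intros hfg; destruct k as [|k]; simpl.
- intros [K hK]; exists K.
  apply near_imp with (2 := near_and _ _ _ hfg hK).
  intros u [e h]; now rewrite <- e.
- intros [q [hq he]]; exists q; split; [exact hq|].
  pose proof (near_self _ _ hfg) as e0; simpl in e0.
  apply near_imp with (2 := near_and _ _ _ hfg he).
  intros u [e h]; now rewrite <- e, <- e0.
Qed.

Lemma jet_O_of_S (f : C -> C) (z : C) : jet 1 f z -> jet 0 f z.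
Proof.
intros [q [[K hK] he]]; exists (Cmod (f z) + 1 * K).
apply near_imp with (2 := near_and _ _ _ (near_and _ _ _ hK he) (near_ball z 1 Rlt_0_1)).
intros u [[h1 h2] h3]; rewrite h2.
eapply Rle_trans; [apply Cmod_triangle|].
rewrite Cmod_mult.
apply Rplus_le_compat_l, Rmult_le_compat; auto using Cmod_ge_0; lra.
Qed.

Lemma jet_pred (k : nat) : forall f z, jet (S k) f z -> jet k f z.
Proof.
induction k as [|k IH]; intros f z; [apply jet_O_of_S|].
intros [q [hq he]]; exists q; split; [now apply IH|exact he].
Qed.

Lemma jet_le (k l : nat) (f : C -> C) (z : C) : (k <= l)%nat -> jet l f z -> jet k f z.
Proof. induction 1; auto using jet_pred. Qed.

Lemma jet_cont (f : C -> C) (z : C) : jet 1 f z -> cont_at f z.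
Proof.
intros [q [[K hK] he]] e hepos.
assert (hK0 : 0 <= K).
{ eapply Rle_trans; [apply Cmod_ge_0|exact (near_self _ _ hK)]. }
assert (hd : 0 < e / (K + 1)) by (apply Rdiv_lt_0_compat; lra).
apply near_imp with (2 := near_and _ _ _ (near_and _ _ _ hK he) (near_ball z _ hd)).
intros u [[h1 h2] h3]; rewrite h2.
replace (f z + (u - z) * q u - f z)%C with ((u - z) * q u)%C by ring.
rewrite Cmod_mult.
apply Rle_lt_trans with (Cmod (u - z) * K).
- apply Rmult_le_compat_l; auto using Cmod_ge_0.
- replace e with (e / (K + 1) * (K + 1)) by (field; lra).
  pose proof (Cmod_ge_0 (u - z)); nra.
Qed.

Lemma jet_const (k : nat) (c z : C) : jet k (fun _ => c) z.
Proof.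
revert c; induction k as [|k IH]; intros c.
- exists (Cmod c); exists 1; split; [lra|intros; lra].
- exists (fun _ => RtoC 0); split; [apply IH|].
  exists 1; split; [lra|intros; ring].
Qed.

Lemma jet_id (k : nat) (z : C) : jet k (fun u => u) z.
Proof.
apply jet_pred; exists (fun _ => RtoC 1); split; [apply jet_const|].
exists 1; split; [lra|intros; ring].
Qed.

Lemma jet_add (k : nat) : forall f g z,
  jet k f z -> jet k g z -> jet k (fun u => f u + g u)%C z.
Proof.
induction k as [|k IH]; intros f g z.
- intros [K hK] [L hL]; exists (K + L).
  apply near_imp with (2 := near_and _ _ _ hK hL).
  intros u [h1 h2]; eapply Rle_trans; [apply Cmod_triangle|lra].
- intros [q [hq he]] [r [hr hf]]; exists (fun u => q u + r u)%C; split; [now apply IH|].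
  apply near_imp with (2 := near_and _ _ _ he hf).
  intros u [h1 h2]; rewrite h1, h2; ring.
Qed.

(** Product rule for divided differences: the quotient of f g is f(z) r + q g, where q and r are
    those of f and g. Keeping g itself costs nothing, as [jet_pred] lowers its order. *)
Lemma jet_mul (k : nat) : forall f g z,
  jet k f z -> jet k g z -> jet k (fun u => f u * g u)%C z.
Proof.
induction k as [|k IH]; intros f g z.
- intros [K hK] [L hL]; exists (K * L).
  apply near_imp with (2 := near_and _ _ _ hK hL).
  intros u [h1 h2]; rewrite Cmod_mult; apply Rmult_le_compat; auto using Cmod_ge_0.
- intros [q [hq he]] hg; pose proof hg as [r [hr hf]].
  exists (fun u => f z * r u + q u * g u)%C; split.
  + apply jet_add; apply IH; auto using jet_const, jet_pred.
  + apply near_imp with (2 := near_and _ _ _ he hf).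
    intros u [h1 h2]; rewrite h1, h2; ring.
Qed.

(** Chain rule for divided differences: the quotient of F o f is q times Q o f. Continuity of f is a
    separate assumption because [jet 0] only gives boundedness. *)
Lemma jet_comp (k : nat) : forall F f z,
  cont_at f z -> jet k F (f z) -> jet k f z -> jet k (fun u => F (f u)) z.
Proof.
induction k as [|k IH]; intros F f z hc.
- intros [K hK] _; exists K.
  exact (near_comp f z (fun v => Cmod (F v) <= K) hc hK).
- intros [Q [hQ hE]] hf; pose proof hf as [q [hq he]].
  exists (fun u => q u * Q (f u))%C; split.
  + apply jet_mul; [exact hq|]; apply IH; auto using jet_pred.
  + apply near_imp with (2 := near_and _ _ _ he (near_comp f z _ hc hE)).
    intros u [h1 h2]; rewrite h2, h1 at 1; ring.
Qed.

Lemma near_Cmod_gt (c : C) (d : R) : d < Cmod c -> near c (fun u => d < Cmod u).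
Proof.
intros hc; exists (Cmod c - d); split; [lra|].
intros u hu.
pose proof (Cmod_triangle u (c - u)) as h.
replace (u + (c - u))%C with c in h by ring.
replace (c - u)%C with (- (u - c))%C in h by ring; rewrite Cmod_opp in h; lra.
Qed.

(** The divided difference of 1/u at c is -1/(c u), again a multiple of the inverse, so the
    induction closes on itself. *)
Lemma jet_inv_id (k : nat) (c : C) : c <> RtoC 0 -> jet k Cinv c.
Proof.
intros hc; assert (hc' : 0 < Cmod c) by now apply Cmod_gt_0.
induction k as [|k IH].
- exists (/ (Cmod c / 2)).
  apply near_imp with (2 := near_Cmod_gt c (Cmod c / 2) ltac:(lra)).
  intros u hu; rewrite Cmod_inv by (apply Cmod_gt_0; lra).
  apply Rinv_le_contravar; lra.
- exists (fun u => - / c * / u)%C; split.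
  + apply jet_mul; auto using jet_const.
  + apply near_imp with (2 := near_Cmod_gt c 0 hc').
    intros u hu; apply Cmod_gt_0 in hu; field; auto.
Qed.

Lemma jet_inv (k : nat) (f : C -> C) (z : C) :
  cont_at f z -> f z <> RtoC 0 -> jet k f z -> jet k (fun u => / f u)%C z.
Proof. intros hc h0 hf; apply (jet_comp k Cinv f z hc); auto using jet_inv_id. Qed.

Lemma jet_pow (k m : nat) (f : C -> C) (z : C) : jet k f z -> jet k (fun u => f u ^ m)%C z.
Proof.
intros hf; induction m as [|m IH]; simpl; [apply jet_const|].
now apply jet_mul.
Qed.

Lemma jet3_expand (f : C -> C) (z : C) : jet 3 f z ->
  exists c1 c2 K, near z (fun u => exists r, Cmod r <= K /\
    f u = (f z + c1 * (u - z) + c2 * (u - z) ^ 2 + r * (u - z) ^ 3)%C).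
Proof.
intros [q [[s [[r [[K hK] hr]] hs]] hq]].
exists (q z), (s z), K.
apply near_imp with (2 := near_and _ _ _ hq (near_and _ _ _ hs (near_and _ _ _ hr hK))).
intros u [h1 [h2 [h3 h4]]]; exists (r u); split; [exact h4|].
rewrite h1, h2, h3; ring.
Qed.

(** Lets a Taylor remainder b be dropped at a cost linear in |b|. *)
Lemma Cmod_sqr_lower (a b : C) : Cmod a ^ 2 - 2 * (Cmod a * Cmod b) <= Cmod (a + b) ^ 2.
Proof.
pose proof (Cmod_triangle (a + b) (- b)) as h.
replace (a + b + - b)%C with a in h by ring; rewrite Cmod_opp in h.
pose proof (Cmod_ge_0 a); pose proof (Cmod_ge_0 b); pose proof (Cmod_ge_0 (a + b)).
destruct (Rle_lt_dec (Cmod a) (Cmod b)); nra.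
Qed.

(* The four points z + i^j t: the cross terms of the expansion
   average out, while |u|^2 gains t^2. *)
Lemma no_local_max (f : C -> C) (z : C) (e : R) : 0 < e -> jet 3 f z ->
  ~ near z (fun u => Cmod (f u) ^ 2 + e * Cmod u ^ 2 <= Cmod (f z) ^ 2 + e * Cmod z ^ 2).
Proof.
intros he hf hmax.
destruct (jet3_expand f z hf) as [c1 [c2 [K hx]]].
destruct (near_and _ _ _ hmax hx) as [d [hd H]]; clear hmax hx.
(* B bounds the quadratic Taylor polynomial at distance t <= 1 from z; K bounds the remainder
   coefficient. *)
set (B := Cmod (f z) + Cmod c1 + Cmod c2).
assert (hB : 0 <= B) by (unfold B; pose proof (Cmod_ge_0 (f z));
  pose proof (Cmod_ge_0 c1); pose proof (Cmod_ge_0 c2); lra).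
assert (hK : 0 <= K).
{ destruct (H z) as [_ [r [hr _]]]; [|pose proof (Cmod_ge_0 r); lra].
  replace (z - z)%C with (RtoC 0) by ring; now rewrite Cmod_0. }
(* t <= 1 serves the bound B, t < d keeps the four points where the expansion holds, and the last
   term gives 2 B K t < e: the cubic loss stays below the gain e t^2. *)
set (t := Rmin (Rmin 1 (d / 2)) (e / (2 * B * K + e))).
assert (hden : 0 < 2 * B * K + e) by (assert (0 <= B * K) by (apply Rmult_le_pos; auto); lra).
assert (ht : 0 < t).
{ unfold t; repeat apply Rmin_pos; try lra; apply Rdiv_lt_0_compat; lra. }
assert (ht1 : t <= 1) by (unfold t; eapply Rle_trans; [apply Rmin_l|apply Rmin_l]).
assert (htd : t < d).
{ apply Rle_lt_trans with (d / 2); [|lra].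
  unfold t; eapply Rle_trans; [apply Rmin_l|apply Rmin_r]. }
assert (hte : 2 * B * K * t < e).
{ apply Rlt_le_trans with (t * (2 * B * K + e)); [nra|].
  apply Rle_trans with (e / (2 * B * K + e) * (2 * B * K + e)).
  - apply Rmult_le_compat_r; [lra|apply Rmin_r].
  - right; field; lra. }
assert (key : forall w, Cmod w = 1 ->
  Cmod (f z + c1 * (w * t) + c2 * (w * t) ^ 2) ^ 2 - 2 * (B * (K * t ^ 3))
   + e * Cmod (z + w * t) ^ 2 <= Cmod (f z) ^ 2 + e * Cmod z ^ 2).
{ intros w hw.
  assert (hwt : Cmod (w * t) = t) by (rewrite Cmod_mult, hw, Cmod_R, Rabs_pos_eq; lra).
  destruct (H (z + w * t)%C) as [h1 [r [hr h2]]].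
  { replace (z + w * t - z)%C with (w * t)%C by ring; lra. }
  eapply Rle_trans; [|exact h1]; apply Rplus_le_compat_r; rewrite h2.
  replace (z + w * t - z)%C with (w * t)%C by ring.
  eapply Rle_trans; [|apply Cmod_sqr_lower].
  apply Rplus_le_compat_l, Ropp_le_contravar, Rmult_le_compat_l; [lra|].
  apply Rmult_le_compat; auto using Cmod_ge_0.
  - unfold B.
    eapply Rle_trans; [apply Cmod_triangle|].
    apply Rplus_le_compat.
    + eapply Rle_trans; [apply Cmod_triangle|].
      apply Rplus_le_compat_l; rewrite Cmod_mult, hwt.
      pose proof (Cmod_ge_0 c1); nra.
    + rewrite Cmod_mult, Cmod_pow, hwt.
      pose proof (Cmod_ge_0 c2); assert (t ^ 2 <= 1) by (simpl; nra); nra.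
  - rewrite Cmod_mult, Cmod_pow, hwt; apply Rmult_le_compat_r; [|exact hr].
    apply pow_le; lra. }
assert (m1 : Cmod (RtoC 1) = 1) by apply Cmod_1.
assert (m2 : Cmod (- RtoC 1) = 1) by (rewrite Cmod_opp; apply Cmod_1).
assert (m4 : Cmod (- Ci) = 1) by (rewrite Cmod_opp; apply Cmod_Ci).
pose proof (key _ m1) as k1; pose proof (key _ m2) as k2.
pose proof (key _ Cmod_Ci) as k3; pose proof (key _ m4) as k4.
clear key H; rewrite !Cmod2_alt in k1, k2, k3, k4.
(* Sum of the four inequalities. Both w and w^2 sum to 0 over the fourth roots of unity; two
   opposite points would leave the product of [f z] and c2. *)
assert (S : 4 * e * t ^ 2 <= 8 * (B * (K * t ^ 3))).
{ destruct (f z) as [f1 f2], c1 as [a1 a2], c2 as [b1 b2], z as [z1 z2].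
  clearbody B t; simpl in k1, k2, k3, k4.
  assert (0 <= (a1 ^ 2 + a2 ^ 2) * t ^ 2) by (apply Rmult_le_pos; nra).
  assert (0 <= (b1 ^ 2 + b2 ^ 2) * t ^ 4) by (apply Rmult_le_pos; [nra|apply pow_le; lra]).
  simpl in *; lra. }
assert (t ^ 2 * (2 * B * K * t) < t ^ 2 * e) by (apply Rmult_lt_compat_l; [apply pow_lt|]; lra).
simpl in *; nra.
Qed.

(** * Maximum principle and Schwarz's lemma *)

Lemma Cmod_lt_of_components (u : C) (d : R) :
  Rabs (fst u) < d / 2 -> Rabs (snd u) < d / 2 -> Cmod u < d.
Proof.
intros h1 h2; eapply Rle_lt_trans; [apply Cmod_2Rmax|].
assert (sqrt 2 < 2).
{ rewrite <- (sqrt_Rsqr 2) at 2 by lra; apply sqrt_lt_1; unfold Rsqr; lra. }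
assert (Rmax (Rabs (fst u)) (Rabs (snd u)) < d / 2) by now apply Rmax_lub_lt.
pose proof (Rabs_pos (fst u)); pose proof (Rmax_l (Rabs (fst u)) (Rabs (snd u))).
pose proof (sqrt_pos 2); nra.
Qed.

(** Bolzano-Weierstrass by contradiction. If no point clusters, each l has a gauge d for which x n
    being d-close to l forces d n < 1; a single number thus encodes both a radius and an index
    bound. Compactness of the square bounds the gauge below, so all indices n would be bounded. *)
Lemma bounded_cluster (x : nat -> C) (r : R) : (forall n, Cmod (x n) <= r) ->
  exists l, forall d, 0 < d -> forall N, exists n, (N <= n)%nat /\ Cmod (x n - l) < d.
Proof.
intros hr; apply NNPP; intros hno.
assert (H : forall l : C, exists d : posreal,
  forall n, Rabs (fst (x n) - fst l) < d -> Rabs (snd (x n) - snd l) < d ->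
    d * INR n < 1).
{ intros l.
  assert (h : exists d, 0 < d /\ exists N, forall n, (N <= n)%nat -> d <= Cmod (x n - l)).
  { apply NNPP; intros h; apply hno; exists l; intros d hd N.
    apply NNPP; intros h'; apply h; exists d; split; [exact hd|].
    exists N; intros n hn; destruct (Rle_lt_dec d (Cmod (x n - l))); [assumption|].
    exfalso; apply h'; now exists n. }
  destruct h as [d [hd [N hN]]].
  assert (hN0 : 0 < INR N + 1) by (pose proof (pos_INR N); lra).
  assert (hp : 0 < Rmin (d / 2) (/ (INR N + 1))).
  { apply Rmin_pos; [lra|now apply Rinv_0_lt_compat]. }
  exists (mkposreal _ hp); simpl; intros n h1 h2.
  destruct (Nat.le_gt_cases N n) as [hn|hn].
  - exfalso; apply (Rlt_not_le _ _ (Cmod_lt_of_components (x n - l) d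
      (Rlt_le_trans _ _ _ h1 (Rmin_l _ _)) (Rlt_le_trans _ _ _ h2 (Rmin_l _ _)))); auto.
  - apply lt_INR in hn.
    apply Rle_lt_trans with (/ (INR N + 1) * INR n).
    + apply Rmult_le_compat_r; [apply pos_INR|apply Rmin_r].
    + apply Rlt_le_trans with (/ (INR N + 1) * (INR N + 1)); [|rewrite Rinv_l; lra].
      apply Rmult_lt_compat_l; [now apply Rinv_0_lt_compat|lra]. }
destruct (functional_choice _ H) as [delta hdelta].
destruct (compactness_value_2d (-r) r (-r) r (fun u v => delta (u, v))) as [d hd].
destruct (INR_archimed d 1 (cond_pos d)) as [n hn].
pose proof (Rle_trans _ _ _ (Rmax_Cmod (x n)) (hr n)) as hm.
assert (b1 : -r <= fst (x n) <= r).
{ apply Rabs_le_between; eapply Rle_trans; [apply Rmax_l|exact hm]. }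
assert (b2 : -r <= snd (x n) <= r).
{ apply Rabs_le_between; eapply Rle_trans; [apply Rmax_r|exact hm]. }
apply (hd _ _ b1 b2); intros [u [v [_ [_ [h1 [h2 h3]]]]]].
pose proof (hdelta (u, v) n h1 h2).
pose proof (pos_INR n).
assert (d * INR n <= delta (u, v) * INR n) by now apply Rmult_le_compat_r.
lra.
Qed.

Lemma exists_large_inv (e : R) : 0 < e -> exists N, forall n, (N <= n)%nat -> / (INR n + 1) < e.
Proof.
intros he; destruct (INR_archimed e 1 he) as [N hN]; exists N; intros n hn.
apply le_INR in hn; pose proof (pos_INR n).
apply Rmult_lt_reg_r with (INR n + 1); [lra|].
rewrite Rinv_l by lra; nra.
Qed.

(** Upper semicontinuity is assumed instead of continuity because one application is to a function
    with jumps. At a cluster point of a maximising sequence f cannot lie below the limit of the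
    values; the same argument first shows that f is bounded above. *)
Lemma disk_usc_max (f : C -> R) (r : R) : 0 <= r ->
  (forall z, Cmod z <= r -> forall e, 0 < e -> near z (fun u => Cmod u <= r -> f u < f z + e)) ->
  exists z, Cmod z <= r /\ forall u, Cmod u <= r -> f u <= f z.
Proof.
intros hr husc.
assert (hcl : forall x : nat -> C, (forall n, Cmod (x n) <= r) ->
  exists l, Cmod l <= r /\ forall e, 0 < e -> forall N, exists n, (N <= n)%nat /\ f (x n) < f l + e).
{ intros x hx; destruct (bounded_cluster x r hx) as [l hl]; exists l.
  assert (hlr : Cmod l <= r).
  { apply Rnot_lt_le; intros h; destruct (near_Cmod_gt l r h) as [d [hd hd']].
    destruct (hl d hd 0%nat) as [n [_ hn]]; apply hd' in hn; specialize (hx n); lra. }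
  split; [exact hlr|]; intros e he N.
  destruct (husc l hlr e he) as [d [hd hd']].
  destruct (hl d hd N) as [n [hn hn']]; exists n; split; auto. }
assert (hb : exists M, forall u, Cmod u <= r -> f u <= M).
{ apply NNPP; intros hno.
  assert (H : forall n : nat, exists u, Cmod u <= r /\ INR n < f u).
  { intros n; apply NNPP; intros h; apply hno; exists (INR n); intros u hu.
    apply Rnot_lt_le; intros h'; apply h; now exists u. }
  destruct (functional_choice _ H) as [x hx].
  destruct (hcl x (fun n => proj1 (hx n))) as [l [_ hl]].
  destruct (INR_archimed 1 (f l + 1) Rlt_0_1) as [N hN].
  destruct (hl 1 Rlt_0_1 N) as [n [hn hn']].
  apply le_INR in hn; pose proof (proj2 (hx n)); lra. }
destruct hb as [M hM].
destruct (completeness (fun y => exists u, Cmod u <= r /\ y = f u)) as [s [hs1 hs2]].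
- exists M; intros y [u [hu ->]]; auto.
- exists (f (RtoC 0)), (RtoC 0); split; [now rewrite Cmod_0|reflexivity].
- assert (H : forall n : nat, exists u, Cmod u <= r /\ s - / (INR n + 1) < f u).
  { intros n; apply NNPP; intros h.
    assert (0 < / (INR n + 1)) by (apply Rinv_0_lt_compat; pose proof (pos_INR n); lra).
    assert (s <= s - / (INR n + 1)); [|lra].
    apply hs2; intros y [u [hu ->]]; apply Rnot_lt_le; intros h'; apply h; now exists u. }
  destruct (functional_choice _ H) as [x hx].
  destruct (hcl x (fun n => proj1 (hx n))) as [l [hl1 hl]].
  exists l; split; [exact hl1|]; intros u hu.
  apply Rle_trans with s; [apply hs1; now exists u|].
  apply Rnot_lt_le; intros h.
  destruct (exists_large_inv ((s - f l) / 2)) as [N hN]; [lra|].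
  destruct (hl ((s - f l) / 2) ltac:(lra) N) as [n [hn hn']].
  pose proof (proj2 (hx n)); specialize (hN n hn); lra.
Qed.

Lemma min_modulus_point (r : R) (B : C -> Prop) (z1 : C) :
  (forall z, Cmod z < r -> ~ B z -> near z (fun u => ~ B u)) -> Cmod z1 < r -> B z1 ->
  exists z0, Cmod z0 < r /\ B z0 /\ forall u, Cmod u < Cmod z0 -> ~ B u.
Proof.
intros hopen hz1 hB1.
(* Maximising f minimises the modulus over B: off B its value is below all values taken on B in the
   disk of radius |z1|. It is upper semicontinuous because the complement of B is open. *)
pose (f := fun z => if excluded_middle_informative (B z) then - Cmod z else - Cmod z1 - 1).
destruct (disk_usc_max f (Cmod z1)) as [z0 [hz0 hmax]].
- apply Cmod_ge_0.
- intros z hz e he; unfold f at 2.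
  destruct (excluded_middle_informative (B z)) as [hB|hB].
  + apply near_imp with (2 := near_Cmod_gt z (Cmod z - e) ltac:(lra)).
    intros u hu hu1; unfold f; destruct (excluded_middle_informative (B u)); lra.
  + apply near_imp with (2 := hopen z ltac:(lra) hB).
    intros u hu _; unfold f; destruct (excluded_middle_informative (B u)); [tauto|lra].
- pose proof (hmax z1 (Rle_refl _)) as h1; unfold f at 1 in h1.
  destruct (excluded_middle_informative (B z1)); [|tauto].
  assert (hB0 : B z0).
  { apply NNPP; intros h; unfold f in h1.
    destruct (excluded_middle_informative (B z0)); [tauto|lra]. }
  exists z0; split; [lra|split; [exact hB0|]].
  intros u hu hBu; specialize (hmax u ltac:(lra)); unfold f in hmax.
  destruct (excluded_middle_informative (B u)); [|tauto].
  destruct (excluded_middle_informative (B z0)); [|tauto]; lra.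
Qed.

Lemma sqr_cont (M e : R) : 0 <= M -> 0 < e ->
  exists d, 0 < d /\ forall y, 0 <= y < M + d -> y ^ 2 < M ^ 2 + e.
Proof.
intros hM he; set (d := Rmin 1 (e / (2 * M + 2))).
assert (hd : 0 < d) by (apply Rmin_pos; [lra|apply Rdiv_lt_0_compat; lra]).
exists d; split; [exact hd|intros y [hy0 hy]].
assert (d <= 1) by apply Rmin_l.
assert (d * (2 * M + 2) <= e).
{ apply Rle_trans with (e / (2 * M + 2) * (2 * M + 2)).
  - apply Rmult_le_compat_r; [lra|apply Rmin_r].
  - right; field; lra. }
simpl; nra.
Qed.

Lemma near_Cmod_sqr_lt (f : C -> C) (z : C) (e : R) : cont_at f z -> 0 < e ->
  near z (fun u => Cmod (f u) ^ 2 < Cmod (f z) ^ 2 + e).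
Proof.
intros hf he; destruct (sqr_cont (Cmod (f z)) e (Cmod_ge_0 _) he) as [d [hd h]].
apply near_imp with (2 := hf d hd); intros u hu; apply h.
split; [apply Cmod_ge_0|].
pose proof (Cmod_triangle (f u - f z) (f z)) as ht.
replace (f u - f z + f z)%C with (f u) in ht by ring; lra.
Qed.

(** The function |f|^2 + e |z|^2 has no interior maximum: off the origin this is [no_local_max], and
    at the origin its value 0 is below the one at z = r. The linear bound supplies semicontinuity at
    the origin, where no expansion is assumed. Finally e tends to 0. *)
Lemma punctured_max_principle (f : C -> C) (r A M : R) :
  0 < r -> f (RtoC 0) = RtoC 0 ->
  near (RtoC 0) (fun u => Cmod (f u) <= A * Cmod u) ->
  (forall z, z <> RtoC 0 -> Cmod z <= r -> jet 3 f z) ->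
  (forall z, Cmod z = r -> Cmod (f z) <= M) ->
  forall z, Cmod z <= r -> Cmod (f z) <= M.
Proof.
intros hr h0 hA hj hM.
assert (hM0 : 0 <= M).
{ eapply Rle_trans; [apply Cmod_ge_0|apply (hM (RtoC r))].
  rewrite Cmod_R; apply Rabs_pos_eq; lra. }
assert (hA0 : 0 <= A).
{ destruct hA as [d [hd h]].
  assert (Cmod (RtoC (d / 2)) = d / 2) as e by (rewrite Cmod_R; apply Rabs_pos_eq; lra).
  specialize (h (RtoC (d / 2))).
  replace (RtoC (d / 2) - RtoC 0)%C with (RtoC (d / 2)) in h by ring.
  rewrite e in h; specialize (h ltac:(lra)).
  pose proof (Cmod_ge_0 (f (RtoC (d / 2)))); nra. }
assert (main : forall e, 0 < e -> forall z, Cmod z <= r -> Cmod (f z) ^ 2 <= M ^ 2 + e * r ^ 2).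
{ intros e he.
  destruct (disk_usc_max (fun z => Cmod (f z) ^ 2 + e * Cmod z ^ 2) r) as [z0 [hz0 hmax]].
  - lra.
  - intros z hz e' he'.
    destruct (Req_dec (Cmod z) 0) as [hz'|hz'].
    + apply Cmod_eq_0 in hz'; subst z; rewrite h0, Cmod_0.
      assert (hd : 0 < e' / ((A ^ 2 + e) * (1 + r))).
      { apply Rdiv_lt_0_compat; [lra|apply Rmult_lt_0_compat; [simpl; nra|lra]]. }
      apply near_imp with (2 := near_and _ _ _ hA (near_ball (RtoC 0) _ hd)).
      intros u [h1 h2] h3.
      replace (u - RtoC 0)%C with u in h2 by ring.
      pose proof (Cmod_ge_0 u); pose proof (Cmod_ge_0 (f u)).
      assert (Cmod (f u) ^ 2 <= (A * Cmod u) ^ 2) by (apply pow_incr; lra).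
      assert (h4 : Cmod u * ((A ^ 2 + e) * (1 + r)) < e').
      { replace e' with (e' / ((A ^ 2 + e) * (1 + r)) * ((A ^ 2 + e) * (1 + r))).
        - apply Rmult_lt_compat_r; [apply Rmult_lt_0_compat; [simpl; nra|lra]|exact h2].
        - field; split; [lra|simpl; nra]. }
      assert (0 <= (A ^ 2 + e) * Cmod u) by (apply Rmult_le_pos; [simpl; nra|lra]).
      simpl in *; nra.
    + assert (hzn : z <> RtoC 0) by (intros ->; now rewrite Cmod_0 in hz').
      assert (hc : cont_at f z) by (apply jet_cont, (jet_le 1 3); [lia|auto]).
      assert (hi : cont_at (fun u => u) z) by (apply jet_cont, jet_id).
      assert (he2 : 0 < e' / 2 / e) by (apply Rdiv_lt_0_compat; lra).
      apply near_imp with (2 := near_and _ _ _ (near_Cmod_sqr_lt f z (e' / 2) hc ltac:(lra))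
         (near_Cmod_sqr_lt _ z _ hi he2)).
      intros u [h1 h2] _.
      apply (Rmult_lt_compat_l e) in h2; [|lra].
      replace (e * (Cmod z ^ 2 + e' / 2 / e)) with (e * Cmod z ^ 2 + e' / 2) in h2 by (field; lra).
      lra.
  - assert (hbd : Cmod z0 = r).
    { destruct (Rle_lt_or_eq_dec _ _ hz0) as [hlt|heq]; [exfalso|exact heq].
      destruct (Req_dec (Cmod z0) 0) as [hz'|hz'].
      - apply Cmod_eq_0 in hz'; subst z0.
        assert (er : Cmod (RtoC r) = r) by (rewrite Cmod_R; apply Rabs_pos_eq; lra).
        specialize (hmax (RtoC r)); rewrite er, h0, Cmod_0 in hmax.
        specialize (hmax (Rle_refl _)).
        pose proof (pow2_ge_0 (Cmod (f (RtoC r)))).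
        assert (0 < e * r ^ 2) by (apply Rmult_lt_0_compat; [|apply pow_lt]; lra).
        simpl in *; lra.
      - assert (hzn : z0 <> RtoC 0) by (intros ->; now rewrite Cmod_0 in hz').
        apply (no_local_max f z0 e he); [auto|].
        exists (r - Cmod z0); split; [lra|]; intros u hu; apply hmax.
        pose proof (Cmod_triangle (u - z0) z0) as ht.
        replace (u - z0 + z0)%C with u in ht by ring; lra. }
    intros z hz; specialize (hmax z hz); rewrite hbd in hmax.
    assert (0 <= e * Cmod z ^ 2) by (apply Rmult_le_pos; [lra|apply pow2_ge_0]).
    assert (Cmod (f z0) ^ 2 <= M ^ 2) by (apply pow_incr; split; [apply Cmod_ge_0|auto]).
    lra. }
intros z hz; apply Rnot_lt_le; intros hlt.
assert (hs : 0 < Cmod (f z) ^ 2 - M ^ 2) by (simpl; nra).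
assert (hr2 : 0 < r ^ 2) by (apply pow_lt; lra).
(* With this e the error e r^2 is half of the supposed excess. *)
specialize (main ((Cmod (f z) ^ 2 - M ^ 2) / 2 / r ^ 2)
  ltac:(repeat apply Rdiv_lt_0_compat; lra) z hz).
replace ((Cmod (f z) ^ 2 - M ^ 2) / 2 / r ^ 2 * r ^ 2)
  with ((Cmod (f z) ^ 2 - M ^ 2) / 2) in main by (field; lra).
lra.
Qed.

(** Otherwise b = x / y^n > 1 satisfies b^m y <= 1 for every m > 0, although b^m is unbounded. The
    extra factor y is the price of an exponent n m - 1 instead of n m. *)
Lemma pow_le_root_limit (x y : R) (n : nat) : 0 <= x -> 0 < y ->
  (forall m, (0 < m)%nat -> x ^ m * y <= (y ^ n) ^ m) -> x <= y ^ n.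
Proof.
intros hx hy H; apply Rnot_lt_le; intros hlt.
assert (hyn : 0 < y ^ n) by now apply pow_lt.
set (b := x / y ^ n).
assert (hb : 1 < b) by (unfold b; apply Rlt_div_r; lra).
assert (hb0 : Rabs b > 1) by (rewrite Rabs_pos_eq; lra).
destruct (Pow_x_infinity b hb0 (/ y + 1)) as [N hN].
specialize (hN (S N) ltac:(lia)); rewrite Rabs_pos_eq in hN by (apply pow_le; lra).
specialize (H (S N) ltac:(lia)).
replace x with (b * y ^ n) in H by (unfold b; field; lra).
rewrite Rpow_mult_distr in H.
assert (hp : 0 < (y ^ n) ^ S N) by now apply pow_lt.
assert (b ^ S N * y <= 1) by (apply Rmult_le_reg_r with (1 := hp); lra).
assert ((/ y + 1) * y <= b ^ S N * y) by (apply Rmult_le_compat_r; lra).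
rewrite Rmult_plus_distr_r, Rinv_l in H1 by lra; lra.
Qed.

(* The maximum principle is applied to w^m / z^(nm-1), which vanishes at 0
   without any removable singularity theorem; then m tends to infinity. *)
Lemma schwarz_order (w : C -> C) (n : nat) (R0 A : R) :
  (0 < n)%nat -> 0 < R0 ->
  (forall z, Cmod z < R0 -> jet 3 w z) ->
  (forall z, Cmod z < R0 -> Cmod (w z) <= 1) ->
  near (RtoC 0) (fun u => Cmod (w u) <= A * Cmod u ^ n) ->
  forall z, Cmod z < R0 -> Cmod (w z) <= (Cmod z / R0) ^ n.
Proof.
intros hn hR hj h1 hA.
assert (hw0 : w (RtoC 0) = RtoC 0).
{ apply (order_bound_at_0 w (RtoC 0) A n hn), near_imp with (2 := hA); intros u hu.
  now replace (w u - 0)%C with (w u) by ring. }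
(* Radii below R0, since w is controlled in the open disk only. *)
assert (step : forall m r z, (0 < m)%nat -> 0 < r < R0 -> Cmod z <= r ->
  Cmod (w z) ^ m * r ^ (n * m - 1) <= Cmod z ^ (n * m - 1)).
{ intros m r z hm hr hz.
  assert (hnm : (0 < n * m)%nat) by (apply Nat.mul_pos_pos; assumption).
  destruct (Req_dec (Cmod z) 0) as [hz'|hz'].
  { apply Cmod_eq_0 in hz'; subst z; rewrite hw0, Cmod_0, pow_i, Rmult_0_l by exact hm.
    apply pow_le; lra. }
  assert (hz0 : 0 < Cmod z) by (pose proof (Cmod_ge_0 z); lra).
  assert (hzn : z <> RtoC 0) by now apply Cmod_gt_0.
  (* At the origin this product is 0 because w vanishes there, whatever value the inverse takes. *)
  pose proof (punctured_max_principle (fun u => w u ^ m * / u ^ (n * m - 1))%C r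
    (A ^ m) (/ r ^ (n * m - 1))) as P; cbv beta in P.
  assert (Q : Cmod (w z ^ m * / z ^ (n * m - 1)) <= / r ^ (n * m - 1)).
  { apply P; clear P; [lra| | | | |exact hz].
    - rewrite hw0; destruct m; [lia|]; simpl; ring.
    - apply near_imp with (2 := hA); intros u hu.
      destruct (Req_dec (Cmod u) 0) as [hu'|hu'].
      + apply Cmod_eq_0 in hu'; subst u; rewrite hw0, Cmod_0.
        replace (RtoC 0 ^ m)%C with (RtoC 0) by (destruct m; [lia|]; simpl; ring).
        rewrite Cmult_0_l, Cmod_0; lra.
      + assert (hup : 0 < Cmod u) by (pose proof (Cmod_ge_0 u); lra).
        assert (hun : u <> RtoC 0) by now apply Cmod_gt_0.
        rewrite Cmod_mult, Cmod_inv, !Cmod_pow by now apply Cpow_nz.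
        apply Rle_trans with ((A * Cmod u ^ n) ^ m * / Cmod u ^ (n * m - 1)).
        * apply Rmult_le_compat_r; [left; now apply Rinv_0_lt_compat, pow_lt|].
          apply pow_incr; split; [apply Cmod_ge_0|exact hu].
        * right; rewrite Rpow_mult_distr, <- pow_mult.
          replace (n * m)%nat with (S (n * m - 1)) at 1 by lia.
          simpl; field; apply pow_nonzero; lra.
    - intros u hun hur.
      assert (hi : forall k, jet k (fun v => v ^ (n * m - 1))%C u)
        by (intros k; apply jet_pow, jet_id).
      apply jet_mul; [apply jet_pow, hj; lra|].
      apply jet_inv; auto using jet_cont, Cpow_nz.
    - intros u hu.
      assert (hun : u <> RtoC 0) by (apply Cmod_gt_0; lra).
      rewrite Cmod_mult, Cmod_inv, !Cmod_pow, hu by now apply Cpow_nz.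
      rewrite <- (Rmult_1_l (/ r ^ _)) at 2; apply Rmult_le_compat_r.
      + left; apply Rinv_0_lt_compat, pow_lt; lra.
      + rewrite <- (pow1 m); apply pow_incr; split; [apply Cmod_ge_0|apply h1; lra]. }
  rewrite Cmod_mult, Cmod_inv, !Cmod_pow in Q by now apply Cpow_nz.
  assert (hrp : 0 < r ^ (n * m - 1)) by (apply pow_lt; lra).
  assert (hzp : 0 < Cmod z ^ (n * m - 1)) by (apply pow_lt; lra).
  apply Rmult_le_reg_r with (/ Cmod z ^ (n * m - 1)); [now apply Rinv_0_lt_compat|].
  rewrite Rinv_r by lra.
  apply (Rmult_le_compat_r (r ^ (n * m - 1))) in Q; [|lra].
  rewrite Rinv_l in Q by lra; lra. }
intros z hz.
destruct (Req_dec (Cmod z) 0) as [hz'|hz'].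
{ rewrite hz'; apply Cmod_eq_0 in hz'; subst z; rewrite hw0, Cmod_0.
  apply pow_le; right; field; lra. }
assert (hz0 : 0 < Cmod z) by (pose proof (Cmod_ge_0 z); lra).
assert (hq : 0 < Cmod z / R0) by now apply Rdiv_lt_0_compat.
apply pow_le_root_limit; [apply Cmod_ge_0|exact hq|].
intros m hm.
assert (hnm : (0 < n * m)%nat) by (apply Nat.mul_pos_pos; assumption).
(* Here r tends to R0, by continuity of the left-hand side of [step] in r. *)
assert (lim : Cmod (w z) ^ m * R0 ^ (n * m - 1) <= Cmod z ^ (n * m - 1)).
{ apply Rnot_lt_le; intros hlt.
  assert (hc : continuity_pt (fun r => Cmod (w z) ^ m * r ^ (n * m - 1)) R0) by reg.
  destruct (hc (Cmod (w z) ^ m * R0 ^ (n * m - 1) - Cmod z ^ (n * m - 1))) as [d [hd h]]; [lra|].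
  set (r := Rmax (R0 - d / 2) (Rmax (R0 / 2) (Cmod z))).
  assert (hrR : r < R0) by (unfold r; repeat apply Rmax_lub_lt; lra).
  assert (hr1 : R0 - d / 2 <= r) by apply Rmax_l.
  assert (hr2 : R0 / 2 <= r) by (eapply Rle_trans; [apply Rmax_l|apply Rmax_r]).
  assert (hr3 : Cmod z <= r) by (eapply Rle_trans; [apply Rmax_r|apply Rmax_r]).
  specialize (step m r z hm ltac:(lra) hr3).
  specialize (h r); simpl in h; unfold R_dist, D_x, no_cond in h.
  assert (Rabs (r - R0) < d) by (apply Rabs_lt_between; lra).
  specialize (h ltac:(split; [split; [exact I|lra]|assumption])).
  apply Rabs_lt_between in h; lra. }
rewrite <- pow_mult.
replace (n * m)%nat with (S (n * m - 1)) by lia.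
assert (hRp : 0 < R0 ^ (n * m - 1)) by (apply pow_lt; lra).
rewrite <- tech_pow_Rmult, Rmult_comm; apply Rmult_le_compat_l; [lra|].
unfold Rdiv; rewrite Rpow_mult_distr, pow_inv.
apply Rmult_le_reg_r with (1 := hRp).
rewrite Rmult_assoc, Rinv_l by lra; lra.
Qed.

(** * Power series on the unit disk *)

Fixpoint psum (a : nat -> C) (z : C) (n : nat) : C :=
  match n with
  | O => RtoC 0
  | S n => (psum a z n + a n * z ^ n)%C
  end.

Definition Ccv (u : nat -> C) (l : C) : Prop :=
  forall e, 0 < e -> exists N, forall n, (N <= n)%nat -> Cmod (u n - l) < e.

Lemma Ccv_unique (u : nat -> C) (l m : C) : Ccv u l -> Ccv u m -> l = m.
Proof.
intros hl hm.
assert (h : Cmod (l - m) = 0).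
{ apply Rle_antisym; [|apply Cmod_ge_0]; apply Rnot_lt_le; intros h.
  destruct (hl (Cmod (l - m) / 2)) as [N hN]; [lra|].
  destruct (hm (Cmod (l - m) / 2)) as [M hM]; [lra|].
  specialize (hN (N + M)%nat ltac:(lia)); specialize (hM (N + M)%nat ltac:(lia)).
  pose proof (Cmod_triangle (- (u (N + M)%nat - l)) (u (N + M)%nat - m)) as ht.
  rewrite Cmod_opp in ht.
  replace (- (u (N + M)%nat - l) + (u (N + M)%nat - m))%C with (l - m)%C in ht by ring; lra. }
apply Cmod_eq_0 in h.
replace l with (l - m + m)%C by ring; rewrite h; ring.
Qed.

Lemma Ccv_ext (u v : nat -> C) (l : C) : (forall n, u n = v n) -> Ccv u l -> Ccv v l.
Proof.
intros h hu e he; destruct (hu e he) as [N hN]; exists N; intros n hn.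
rewrite <- h; auto.
Qed.

Lemma Ccv_const (c : C) : Ccv (fun _ => c) c.
Proof.
intros e he; exists 0%nat; intros _ _.
replace (c - c)%C with (RtoC 0) by ring; now rewrite Cmod_0.
Qed.

Lemma Ccv_plus (u v : nat -> C) (l m : C) :
  Ccv u l -> Ccv v m -> Ccv (fun n => u n + v n)%C (l + m)%C.
Proof.
intros hu hv e he.
destruct (hu (e / 2)) as [N hN]; [lra|]; destruct (hv (e / 2)) as [M hM]; [lra|].
exists (N + M)%nat; intros n hn.
specialize (hN n ltac:(lia)); specialize (hM n ltac:(lia)).
replace (u n + v n - (l + m))%C with ((u n - l) + (v n - m))%C by ring.
eapply Rle_lt_trans; [apply Cmod_triangle|lra].
Qed.

Lemma Ccv_scal (c : C) (u : nat -> C) (l : C) : Ccv u l -> Ccv (fun n => c * u n)%C (c * l)%C.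
Proof.
intros hu e he; pose proof (Cmod_ge_0 c) as hc.
destruct (hu (e / (Cmod c + 1))) as [N hN]; [apply Rdiv_lt_0_compat; lra|].
exists N; intros n hn; specialize (hN n hn).
replace (c * u n - c * l)%C with (c * (u n - l))%C by ring.
rewrite Cmod_mult.
replace e with ((Cmod c + 1) * (e / (Cmod c + 1))) by (field; lra).
pose proof (Cmod_ge_0 (u n - l)); nra.
Qed.

Lemma Ccv_S (u : nat -> C) (l : C) : Ccv (fun n => u (S n)) l -> Ccv u l.
Proof.
intros hu e he; destruct (hu e he) as [N hN]; exists (S N); intros [|n] hn; [lia|].
apply hN; lia.
Qed.

Lemma Ccv_bound (u : nat -> C) (l : C) (M : R) :
  (forall n, Cmod (u n) <= M) -> Ccv u l -> Cmod l <= M.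
Proof.
intros hM hu; apply Rnot_lt_le; intros h.
destruct (hu (Cmod l - M)) as [N hN]; [lra|].
specialize (hN N (Nat.le_refl _)); specialize (hM N).
pose proof (Cmod_triangle (u N) (- (u N - l))) as ht.
rewrite Cmod_opp in ht.
replace (u N + - (u N - l))%C with l in ht by ring; lra.
Qed.

Definition sums_to (a : nat -> C) (z l : C) : Prop := Ccv (psum a z) l.

Lemma psum_sum_n (a : nat -> C) (z : C) (n : nat) :
  @sum_n (NormedModule.AbelianMonoid C_AbsRing C_NormedModule)
    (fun k => @scal C_AbsRing (NormedModule.ModuleSpace C_AbsRing C_NormedModule)
       (pow_n (z : C_AbsRing) k) (a k)) n = psum a z (S n).
Proof.
assert (hp : forall k, @pow_n (AbsRing.Ring C_AbsRing) z k = (z ^ k)%C).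
{ induction k as [|k IH]; [reflexivity|]; simpl; now rewrite IH. }
induction n as [|n IH].
- rewrite sum_O, hp; simpl; unfold scal; simpl; unfold mult; simpl; ring.
- rewrite sum_Sn, IH, hp; unfold plus, scal; simpl; unfold mult; simpl; ring.
Qed.

Lemma is_pseries_sums_to (a : nat -> C) (z l : C) :
  @is_pseries C_AbsRing C_NormedModule a z l -> sums_to a z l.
Proof.
intros h; apply Ccv_S; intros e he.
(* Balls of [C_UniformSpace] are squares; half the radius keeps them inside the disk of radius e. *)
assert (he' : 0 < e / 2) by lra.
destruct (h (@ball C_UniformSpace l (mkposreal _ he')) (locally_ball _ _)) as [N hN].
exists N; intros n hn; specialize (hN n hn).
rewrite psum_sum_n in hN.
destruct hN as [h1 h2].
apply Cmod_lt_of_components; [exact h1|exact h2].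
Qed.

(** With q = |z| / r the factor r / (r - |z|) is 1 / (1 - q), so this is the finite geometric sum M
    (1 - q^n) / (1 - q), expanded to make the induction linear. *)
Lemma psum_geom_bound (a : nat -> C) (z : C) (r M : R) :
  Cmod z < r -> (forall k, Cmod (a k) * r ^ k <= M) ->
  forall n, Cmod (psum a z n) <= M * (r / (r - Cmod z)) - M * (r / (r - Cmod z)) * (Cmod z / r) ^ n.
Proof.
intros hz hM; pose proof (Cmod_ge_0 z) as hz0.
induction n as [|n IH]; [simpl; rewrite Cmod_0; lra|].
simpl psum; eapply Rle_trans; [apply Cmod_triangle|].
rewrite Cmod_mult, Cmod_pow.
assert (h : Cmod (a n) * Cmod z ^ n <= M * (Cmod z / r) ^ n).
{ replace (Cmod (a n) * Cmod z ^ n) with (Cmod (a n) * r ^ n * (Cmod z / r) ^ n).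
  - apply Rmult_le_compat_r; [|apply hM].
    apply pow_le, Rdiv_le_0_compat; lra.
  - unfold Rdiv; rewrite Rpow_mult_distr, pow_inv; field; apply pow_nonzero; lra. }
simpl pow.
replace (M * (r / (r - Cmod z)) - M * (r / (r - Cmod z)) * (Cmod z / r * (Cmod z / r) ^ n))
  with (M * (r / (r - Cmod z)) - M * (r / (r - Cmod z)) * (Cmod z / r) ^ n
    + M * (Cmod z / r) ^ n) by (field; lra).
lra.
Qed.

Lemma psum_bound (a : nat -> C) (z : C) (r M : R) :
  Cmod z < r -> (forall k, Cmod (a k) * r ^ k <= M) ->
  forall n, Cmod (psum a z n) <= M * (r / (r - Cmod z)).
Proof.
intros hz hM n; pose proof (Cmod_ge_0 z) as hz0.
eapply Rle_trans; [apply (psum_geom_bound a z r M hz hM)|].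
assert (hM0 : 0 <= M).
{ eapply Rle_trans; [|apply (hM 0%nat)]; simpl; pose proof (Cmod_ge_0 (a 0%nat)); lra. }
assert (0 <= M * (r / (r - Cmod z)) * (Cmod z / r) ^ n).
{ repeat apply Rmult_le_pos; try lra.
  - left; apply Rinv_0_lt_compat; lra.
  - apply pow_le, Rdiv_le_0_compat; lra. }
lra.
Qed.

(** Real and imaginary parts are both dominated by the geometric series M (|z| / r)^k. *)
Lemma sums_to_exists (a : nat -> C) (z : C) (r M : R) :
  Cmod z < r -> (forall k, Cmod (a k) * r ^ k <= M) -> exists l, sums_to a z l.
Proof.
intros hz hM; pose proof (Cmod_ge_0 z) as hz0.
assert (hg : ex_series (fun k => M * (Cmod z / r) ^ k)).
{ apply (ex_series_scal M (fun k => (Cmod z / r) ^ k)), ex_series_geom.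
  rewrite Rabs_pos_eq by (apply Rdiv_le_0_compat; lra).
  apply Rlt_div_l; lra. }
assert (hb : forall k, Cmod (a k * z ^ k) <= M * (Cmod z / r) ^ k).
{ intros k; rewrite Cmod_mult, Cmod_pow.
  replace (Cmod (a k) * Cmod z ^ k) with (Cmod (a k) * r ^ k * (Cmod z / r) ^ k).
  - apply Rmult_le_compat_r; [|apply hM].
    apply pow_le, Rdiv_le_0_compat; lra.
  - unfold Rdiv; rewrite Rpow_mult_distr, pow_inv; field; apply pow_nonzero; lra. }
assert (e1 : ex_series (fun k => fst (a k * z ^ k)%C)).
{ apply (@ex_series_le R_AbsRing R_CompleteNormedModule) with (2 := hg).
  intros k; eapply Rle_trans; [|apply hb]; apply re_le_Cmod. }
assert (e2 : ex_series (fun k => snd (a k * z ^ k)%C)).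
{ apply (@ex_series_le R_AbsRing R_CompleteNormedModule) with (2 := hg).
  intros k; eapply Rle_trans; [|apply hb].
  eapply Rle_trans; [apply Rmax_r|apply Rmax_Cmod]. }
destruct e1 as [x hx], e2 as [y hy]; exists (x, y).
assert (s1 : forall n, sum_n (fun k => fst (a k * z ^ k)%C) n = fst (psum a z (S n))).
{ induction n as [|n IH]; [rewrite sum_O; simpl; ring|].
  rewrite sum_Sn, IH; reflexivity. }
assert (s2 : forall n, sum_n (fun k => snd (a k * z ^ k)%C) n = snd (psum a z (S n))).
{ induction n as [|n IH]; [rewrite sum_O; simpl; ring|].
  rewrite sum_Sn, IH; reflexivity. }
apply Ccv_S; intros e he.
assert (he' : 0 < e / 2) by lra.
destruct (hx (ball x (mkposreal _ he')) (locally_ball _ _)) as [N hN].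
destruct (hy (ball y (mkposreal _ he')) (locally_ball _ _)) as [N' hN'].
exists (N + N')%nat; intros n hn.
specialize (hN n ltac:(lia)); specialize (hN' n ltac:(lia)).
rewrite s1 in hN; rewrite s2 in hN'.
apply Cmod_lt_of_components; [exact hN|exact hN'].
Qed.

(** Radius of convergence at least 1, stated as a coefficient bound so that it passes directly to
    shifted and tail sequences. *)
Definition unit_radius (a : nat -> C) : Prop :=
  forall r, 0 < r < 1 -> exists M, forall k, Cmod (a k) * r ^ k <= M.

Lemma finite_bound (f : nat -> R) (N : nat) : exists M, forall k, (k < N)%nat -> f k <= M.
Proof.
induction N as [|N [M hM]]; [exists 0; lia|].
exists (Rmax M (f N)); intros k hk.
destruct (Nat.eq_dec k N) as [->|hne]; [apply Rmax_r|].
eapply Rle_trans; [apply hM; lia|apply Rmax_l].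
Qed.

(** A term of the series at r is the difference of two consecutive partial sums; late ones are
    within 1 of the limit, hence the bound 2, and finitely many terms remain. *)
Lemma sums_to_unit_radius (a : nat -> C) (A : C -> C) :
  (forall z, Cmod z < 1 -> sums_to a z (A z)) -> unit_radius a.
Proof.
intros h r hr.
assert (er : Cmod (RtoC r) = r) by (rewrite Cmod_R; apply Rabs_pos_eq; lra).
destruct (h (RtoC r) ltac:(lra) 1 Rlt_0_1) as [N hN].
destruct (finite_bound (fun k => Cmod (a k) * r ^ k) N) as [M hM].
exists (Rmax M 2); intros k.
destruct (Nat.lt_ge_cases k N) as [hk|hk].
- eapply Rle_trans; [now apply hM|apply Rmax_l].
- eapply Rle_trans; [|apply Rmax_r].
  pose proof (hN k hk) as h1; pose proof (hN (S k) ltac:(lia)) as h2; simpl in h2.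
  rewrite <- er at 1; rewrite <- Cmod_pow, <- Cmod_mult.
  pose proof (Cmod_triangle (psum a r k + a k * r ^ k - A r) (- (psum a r k - A r))) as ht.
  rewrite Cmod_opp in ht.
  replace (psum a r k + a k * r ^ k - A r + - (psum a r k - A r))%C
    with (a k * r ^ k)%C in ht by ring; lra.
Qed.

Lemma shift_bound (a : nat -> C) (r M : R) (j : nat) : 0 < r ->
  (forall k, Cmod (a k) * r ^ k <= M) ->
  forall k, Cmod (a (k + j)%nat) * r ^ k <= M / r ^ j.
Proof.
intros hr hM k; assert (hp : 0 < r ^ j) by now apply pow_lt.
apply Rmult_le_reg_r with (1 := hp); unfold Rdiv.
rewrite !Rmult_assoc, Rinv_l, Rmult_1_r, <- pow_add by lra; apply hM.
Qed.

Lemma tails_exist (a : nat -> C) (z : C) : unit_radius a -> Cmod z < 1 ->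
  exists b : nat -> C, forall j, sums_to (fun k => a (k + j)%nat) z (b j).
Proof.
intros ha hz; pose proof (Cmod_ge_0 z) as hz0.
apply (functional_choice (fun j l => sums_to (fun k => a (k + j)%nat) z l)); intros j.
destruct (ha ((Cmod z + 1) / 2)) as [M hM]; [lra|].
apply sums_to_exists with ((Cmod z + 1) / 2) (M / ((Cmod z + 1) / 2) ^ j); [lra|].
apply shift_bound; [lra|exact hM].
Qed.

Lemma psum_S (a : nat -> C) (z : C) (n : nat) :
  psum a z (S n) = (a 0%nat + z * psum (fun k => a (S k)) z n)%C.
Proof.
induction n as [|n IH]; [simpl; ring|].
change (psum a z (S (S n))) with (psum a z (S n) + a (S n) * z ^ S n)%C.
rewrite IH; simpl; ring.
Qed.

Lemma tails_rec (a b : nat -> C) (z : C) :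
  (forall j, sums_to (fun k => a (k + j)%nat) z (b j)) ->
  forall j, b j = (a j + z * b (S j))%C.
Proof.
intros hb j; apply (Ccv_unique _ _ _ (hb j)); apply Ccv_S.
apply Ccv_ext with (fun n => a j + z * psum (fun k => a (k + S j)%nat) z n)%C.
- intros n; rewrite psum_S; simpl; f_equal; f_equal.
  clear; induction n as [|n IH]; [reflexivity|]; simpl; rewrite IH.
  now rewrite Nat.add_succ_r.
- apply Ccv_plus; [apply Ccv_const|apply Ccv_scal, hb].
Qed.

(** Horner's recursion for the tails makes the left-hand side telescope. For u = z it vanishes,
    which expresses a sum as a partial sum plus b n z^n. *)
Lemma tails_division (a b : nat -> C) (z u : C) :
  (forall j, b j = (a j + z * b (S j))%C) ->
  forall n, ((u - z) * psum (fun j => b (S j)) u n = psum a u n - b 0%nat + b n * u ^ n)%C.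
Proof.
intros hb; induction n as [|n IH]; simpl; [ring|].
rewrite Cmult_plus_distr_l, IH, (hb n); ring.
Qed.

(** For a radius r above both s and |z|, the geometric bound gives |b j| <= C / r^j, which s^j <=
    r^j absorbs. *)
Lemma tails_unit_radius (a b : nat -> C) (z : C) : unit_radius a -> Cmod z < 1 ->
  (forall j, sums_to (fun k => a (k + j)%nat) z (b j)) -> unit_radius b.
Proof.
intros ha hz hb s hs; pose proof (Cmod_ge_0 z) as hz0.
set (r := (Rmax s (Cmod z) + 1) / 2).
pose proof (Rmax_l s (Cmod z)); pose proof (Rmax_r s (Cmod z)).
assert (hm : Rmax s (Cmod z) < 1) by (apply Rmax_lub_lt; lra).
assert (hr : s < r < 1 /\ Cmod z < r) by (unfold r; lra).
destruct (ha r) as [M hM]; [lra|].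
exists (M * (r / (r - Cmod z))); intros j.
assert (hbj : Cmod (b j) <= M / r ^ j * (r / (r - Cmod z))).
{ apply (Ccv_bound _ _ _ (psum_bound _ z r _ (proj2 hr)
    (shift_bound a r M j ltac:(lra) hM)) (hb j)). }
assert (hrj : 0 < r ^ j) by (apply pow_lt; lra).
assert (hsr : s ^ j <= r ^ j) by (apply pow_incr; lra).
apply Rle_trans with (Cmod (b j) * r ^ j).
- apply Rmult_le_compat_l; [apply Cmod_ge_0|exact hsr].
- apply Rle_trans with (M / r ^ j * (r / (r - Cmod z)) * r ^ j).
  + apply Rmult_le_compat_r; [lra|exact hbj].
  + right; field; lra.
Qed.

Lemma terms_cv0 (b : nat -> C) (u : C) : unit_radius b -> Cmod u < 1 ->
  Ccv (fun n => b n * u ^ n)%C (RtoC 0).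
Proof.
intros hb hu; pose proof (Cmod_ge_0 u) as hu0.
destruct (hb ((Cmod u + 1) / 2)) as [M hM]; [lra|].
destruct (sums_to_exists b u ((Cmod u + 1) / 2) M) as [l hl]; [lra|exact hM|].
intros e he; destruct (hl (e / 2)) as [N hN]; [lra|].
exists N; intros n hn.
pose proof (hN n hn) as h1; pose proof (hN (S n) ltac:(lia)) as h2; simpl in h2.
pose proof (Cmod_triangle (psum b u n + b n * u ^ n - l) (- (psum b u n - l))) as ht.
rewrite Cmod_opp in ht.
replace (psum b u n + b n * u ^ n - l + - (psum b u n - l))%C
    with (b n * u ^ n - 0)%C in ht by ring; lra.
Qed.

(* Synthetic division: (A u - A z) / (u - z) is again the sum of a power
   series on the unit disk, its coefficients being the tails of the series at z. *)
Lemma power_series_jet (k : nat) : forall (a : nat -> C) (A : C -> C),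
  (forall u, Cmod u < 1 -> sums_to a u (A u)) ->
  forall z, Cmod z < 1 -> jet k A z.
Proof.
induction k as [|k IH]; intros a A hA z hz; pose proof (Cmod_ge_0 z) as hz0;
  pose proof (sums_to_unit_radius a A hA) as ha.
(* |z| < s < r < 1: the geometric bound of radius r is uniform over |u| < s. *)
- set (s := (Cmod z + 1) / 2); set (r := (s + 1) / 2).
  destruct (ha r) as [M hM]; [unfold r, s; lra|].
  assert (hM0 : 0 <= M).
  { eapply Rle_trans; [|apply (hM 0%nat)]; simpl; pose proof (Cmod_ge_0 (a 0%nat)); lra. }
  exists (M * (r / (r - s))), (s - Cmod z); split; [unfold s; lra|].
  intros u hu.
  assert (hus : Cmod u < s).
  { pose proof (Cmod_triangle (u - z) z) as ht.
    replace (u - z + z)%C with u in ht by ring; lra. }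
  assert (hsr : s < r) by (unfold r, s in *; lra).
  eapply Rle_trans.
  + apply (Ccv_bound _ _ _ (psum_bound a u r M ltac:(lra) hM)).
    apply hA; unfold r, s in *; lra.
  + apply Rmult_le_compat_l; [exact hM0|].
    apply Rmult_le_compat_l; [unfold r, s; lra|].
    apply Rinv_le_contravar; lra.
- destruct (tails_exist a z ha hz) as [b hb].
  pose proof (tails_unit_radius a b z ha hz hb) as hbr.
  assert (hb' : unit_radius (fun j => b (S j))).
  { intros r hr; destruct (hbr r hr) as [M hM]; exists (M / r ^ 1); intros j.
    rewrite <- Nat.add_1_r; apply (shift_bound b r M 1); [lra|exact hM]. }
  assert (hex : forall u, exists l, Cmod u < 1 -> sums_to (fun j => b (S j)) u l).
  { intros u; destruct (Rlt_le_dec (Cmod u) 1) as [hu|hu];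
      [|exists (RtoC 0); intros; lra].
    pose proof (Cmod_ge_0 u).
    destruct (hb' ((Cmod u + 1) / 2)) as [M hM]; [lra|].
    destruct (sums_to_exists _ u ((Cmod u + 1) / 2) M ltac:(lra) hM) as [l hl].
    now exists l. }
  destruct (functional_choice _ hex) as [q hq]; clear hex.
  exists q; split; [exact (IH _ _ hq z hz)|].
  assert (e0 : b 0%nat = A z).
  { apply (Ccv_unique _ _ _ (hb 0%nat)).
    apply Ccv_ext with (2 := hA z hz); intros n.
    induction n as [|n IHn]; [reflexivity|]; simpl; now rewrite IHn, Nat.add_0_r. }
  exists (1 - Cmod z); split; [lra|]; intros u hu.
  assert (hu1 : Cmod u < 1).
  { pose proof (Cmod_triangle (u - z) z) as ht.
    replace (u - z + z)%C with u in ht by ring; lra. }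
  assert (e : ((u - z) * q u = A u + (- A z + 0))%C).
  { apply (Ccv_unique (fun n => (u - z) * psum (fun j => b (S j)) u n)%C).
    - apply Ccv_scal, hq, hu1.
    - apply Ccv_ext with (fun n => psum a u n + (- A z + b n * u ^ n))%C.
      + intros n; rewrite (tails_division a b z u (tails_rec a b z hb)), e0; ring.
      + apply Ccv_plus; [now apply hA|].
        apply Ccv_plus; [apply Ccv_const|now apply terms_cv0]. }
  rewrite e; ring.
Qed.

(** Division at u = z gives A(u) - a 0 = b n u^n, as the intermediate coefficients vanish, and the
    tail value b n is bounded near 0. *)
Lemma power_series_order (a : nat -> C) (A : C -> C) (n : nat) :
  (0 < n)%nat -> (forall u, Cmod u < 1 -> sums_to a u (A u)) ->
  (forall k, (0 < k < n)%nat -> a k = RtoC 0) ->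
  exists M, near (RtoC 0) (fun u => Cmod (A u - a 0%nat) <= M * Cmod u ^ n).
Proof.
intros hn hA h0; pose proof (sums_to_unit_radius a A hA) as ha.
destruct (ha (1 / 2)) as [M hM]; [lra|].
assert (hM0 : 0 <= M).
{ eapply Rle_trans; [|apply (hM 0%nat)]; simpl; pose proof (Cmod_ge_0 (a 0%nat)); lra. }
(* The factor 2 bounds r / (r - |u|) for r = 1/2 and |u| < 1/4. *)
exists (M / (1 / 2) ^ n * 2), (1 / 4); split; [lra|]; intros u hu.
replace (u - RtoC 0)%C with u in hu by ring.
destruct (tails_exist a u ha ltac:(lra)) as [b hb].
assert (e0 : b 0%nat = A u).
{ apply (Ccv_unique _ _ _ (hb 0%nat)).
  apply Ccv_ext with (2 := hA u ltac:(lra)); intros m.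
  induction m as [|m IHm]; [reflexivity|]; simpl; now rewrite IHm, Nat.add_0_r. }
assert (en : psum a u n = a 0%nat).
{ clear - hn h0; destruct n as [|n]; [lia|].
  induction n as [|n IH]; [simpl; ring|].
  change (psum a u (S (S n))) with (psum a u (S n) + a (S n) * u ^ S n)%C.
  rewrite (IH ltac:(lia) ltac:(intros; apply h0; lia)), (h0 (S n)) by lia; ring. }
pose proof (tails_division a b u u (tails_rec a b u hb) n) as e; rewrite en, e0 in e.
assert (e' : (A u - a 0%nat = b n * u ^ n)%C).
{ replace (A u - a 0%nat)%C with
    (b n * u ^ n - (a 0%nat - A u + b n * u ^ n))%C by ring.
  rewrite <- e; ring. }
rewrite e', Cmod_mult, Cmod_pow; apply Rmult_le_compat_r; [apply pow_le, Cmod_ge_0|].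
pose proof (Cmod_ge_0 u).
eapply Rle_trans; [apply (Ccv_bound _ _ _ (psum_bound _ u (1 / 2) _ ltac:(lra)
    (shift_bound a (1 / 2) M n ltac:(lra) hM)) (hb n))|].
apply Rmult_le_compat_l.
- apply Rdiv_le_0_compat; [lra|apply pow_lt; lra].
- apply Rle_div_l; lra.
Qed.

(** * Exponential and logarithm *)

(** Each application raises the order of a Taylor remainder by one. The factor 1 / (k + 1) of an
    exact integration is given up, so K never changes. *)
Lemma mvt_pow (g g' : R -> R) (K : R) (k : nat) :
  (forall t, is_derive g t (g' t)) -> g 0 = 0 ->
  (forall t, Rabs t <= 1 -> Rabs (g' t) <= K * Rabs t ^ k) ->
  forall t, Rabs t <= 1 -> Rabs (g t) <= K * Rabs t ^ S k.
Proof.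
intros hd h0 hb t ht.
destruct (MVT_gen g 0 t g') as [c [hc e]].
- intros; apply hd.
- intros x _; apply continuity_pt_filterlim.
  apply (@ex_derive_continuous R_AbsRing R_NormedModule); now exists (g' x).
- rewrite h0, Rminus_0_r, Rminus_0_r in e; rewrite e, Rabs_mult.
  assert (hct : Rabs c <= Rabs t).
  { revert hc; unfold Rmin, Rmax; destruct (Rle_dec 0 t); intros hc.
    - rewrite !Rabs_pos_eq; lra.
    - rewrite !Rabs_left1; lra. }
  assert (hK : Rabs (g' c) <= K * Rabs c ^ k) by (apply hb; lra).
  assert (hK0 : 0 <= K).
  { specialize (hb 1 ltac:(rewrite Rabs_R1; lra)); rewrite Rabs_R1, pow1, Rmult_1_r in hb.
    pose proof (Rabs_pos (g' 1)); lra. }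
  assert (Rabs c ^ k <= Rabs t ^ k) by (apply pow_incr; split; [apply Rabs_pos|exact hct]).
  rewrite <- tech_pow_Rmult, (Rmult_comm (Rabs t)), <- Rmult_assoc.
  apply Rmult_le_compat_r; [apply Rabs_pos|].
  eapply Rle_trans; [exact hK|]; now apply Rmult_le_compat_l.
Qed.

Lemma exp_taylor2 (x : R) : Rabs x <= 1 -> Rabs (exp x - 1 - x - x ^ 2 / 2) <= 3 * Rabs x ^ 3.
Proof.
revert x.
apply (mvt_pow (fun x => exp x - 1 - x - x ^ 2 / 2) (fun x => exp x - 1 - x)).
- intros t; auto_derive; [exact I|]; field.
- rewrite exp_0; field.
- apply (mvt_pow (fun x => exp x - 1 - x) (fun x => exp x - 1)).
  + intros t; auto_derive; [exact I|]; ring.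
  + rewrite exp_0; ring.
  + apply (mvt_pow (fun x => exp x - 1) exp).
    * intros t; auto_derive; [exact I|]; ring.
    * rewrite exp_0; ring.
    * intros t ht; rewrite Rabs_pos_eq by (left; apply exp_pos); simpl.
      apply Rabs_le_between in ht.
      assert (exp t <= exp 1).
      { destruct (Req_dec t 1) as [->|hne]; [lra|]; left; apply exp_increasing; lra. }
      pose proof exp_le_3; lra.
Qed.

Lemma cos_taylor1 (y : R) : Rabs y <= 1 -> Rabs (cos y - 1) <= 1 * Rabs y ^ 2.
Proof.
revert y; apply (mvt_pow (fun y => cos y - 1) (fun y => - sin y)).
- intros t; auto_derive; [exact I|]; ring.
- rewrite cos_0; ring.
- intros t ht; rewrite Rabs_Ropp; revert t ht; apply (mvt_pow sin cos).
  + intros t; auto_derive; [exact I|]; ring.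
  + apply sin_0.
  + intros t _; simpl; pose proof (COS_bound t); apply Rabs_le_between; lra.
Qed.

Lemma sin_taylor1 (y : R) : Rabs y <= 1 -> Rabs (sin y - y) <= 1 * Rabs y ^ 3.
Proof.
revert y; apply (mvt_pow (fun y => sin y - y) (fun y => cos y - 1)).
- intros t; auto_derive; [exact I|]; ring.
- rewrite sin_0; ring.
- apply cos_taylor1.
Qed.

Lemma cos_taylor2 (y : R) : Rabs y <= 1 -> Rabs (cos y - 1 + y ^ 2 / 2) <= 1 * Rabs y ^ 3.
Proof.
revert y; apply (mvt_pow (fun y => cos y - 1 + y ^ 2 / 2) (fun y => - (sin y - y))).
- intros t; auto_derive; [exact I|]; field.
- rewrite cos_0; field.
- intros t ht; rewrite Rabs_Ropp.
  eapply Rle_trans; [now apply sin_taylor1|].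
  pose proof (Rabs_pos t); assert (0 <= Rabs t ^ 2) by apply pow2_ge_0.
  simpl in *; nra.
Qed.

Definition Cexp (z : C) : C := (exp (Re z) * cos (Im z), exp (Re z) * sin (Im z)).

Lemma Cexp_0 : Cexp (RtoC 0) = RtoC 1.
Proof. unfold Cexp, RtoC; simpl; rewrite exp_0, cos_0, sin_0; f_equal; ring. Qed.

Lemma Cexp_add (z w : C) : Cexp (z + w) = (Cexp z * Cexp w)%C.
Proof.
unfold Cexp, Cmult, Re, Im; simpl; rewrite exp_plus, cos_plus, sin_plus; f_equal; ring.
Qed.

Lemma Rabs_mult_le (x y a b : R) : Rabs x <= a -> Rabs y <= b -> Rabs (x * y) <= a * b.
Proof. intros; rewrite Rabs_mult; apply Rmult_le_compat; auto using Rabs_pos. Qed.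

Lemma Rabs_plus_le (x y a b : R) : Rabs x <= a -> Rabs y <= b -> Rabs (x + y) <= a + b.
Proof. intros; eapply Rle_trans; [apply Rabs_triang|lra]. Qed.

(** After the real expansions of exp, cos and sin are multiplied out, everything beyond the
    quadratic part has total degree at least 3. The constant is crude: 20 H^3 for each component,
    and 2 for sqrt 2. *)
Lemma Cexp_taylor2 (h : C) : Cmod h < 1 ->
  Cmod (Cexp h - 1 - h - RtoC (/ 2) * h ^ 2) <= 40 * Cmod h ^ 3.
Proof.
destruct h as [x y]; intros hh; set (H := Cmod (x, y)) in *.
assert (hH : 0 <= H) by apply Cmod_ge_0.
pose proof (Rmax_Cmod (x, y)) as hm; simpl in hm; fold H in hm.
assert (hx : Rabs x <= H) by (eapply Rle_trans; [apply Rmax_l|exact hm]).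
assert (hy : Rabs y <= H) by (eapply Rle_trans; [apply Rmax_r|exact hm]).
assert (px : Rabs x ^ 3 <= H ^ 3) by (apply pow_incr; split; [apply Rabs_pos|exact hx]).
assert (py : Rabs y ^ 3 <= H ^ 3) by (apply pow_incr; split; [apply Rabs_pos|exact hy]).
assert (r1 : Rabs (exp x - 1 - x - x ^ 2 / 2) <= 3 * H ^ 3)
  by (eapply Rle_trans; [apply exp_taylor2; lra|lra]).
assert (r2 : Rabs (cos y - 1 + y ^ 2 / 2) <= H ^ 3)
  by (eapply Rle_trans; [apply cos_taylor2; lra|lra]).
assert (r3 : Rabs (sin y - y) <= H ^ 3)
  by (eapply Rle_trans; [apply sin_taylor1; lra|lra]).
assert (bc : Rabs (cos y) <= 1) by (pose proof (COS_bound y); apply Rabs_le_between; lra).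
assert (bs : Rabs (sin y) <= 1) by (pose proof (SIN_bound y); apply Rabs_le_between; lra).
assert (x1 : Rabs x <= 1) by lra.
assert (p1 : Rabs (1 + x + x * x / 2) <= 3).
{ apply Rabs_le_between in x1; apply Rabs_le_between; nra. }
set (e1 := exp x - 1 - x - x ^ 2 / 2) in *.
set (e2 := cos y - 1 + y ^ 2 / 2) in *.
set (e3 := sin y - y) in *.
assert (hyy : Rabs (y * y) <= H * H) by now apply Rabs_mult_le.
assert (hxx : Rabs (x * x) <= H * H) by now apply Rabs_mult_le.
assert (hxyy : Rabs (x * (y * y)) <= H * (H * H)) by now apply Rabs_mult_le.
assert (hxxy : Rabs (x * x * y) <= H * H * H) by now apply Rabs_mult_le.
assert (q0 : Rabs (- / 2 - x * / 4) <= 1).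
{ apply Rabs_le_between in x1; apply Rabs_le_between; lra. }
assert (q1 : Rabs (/ 2) <= 1) by (rewrite Rabs_pos_eq; lra).
assert (A1 : Rabs (exp x * cos y - (1 + x + (x * x - y * y) / 2)) <= 10 * H ^ 3).
{ replace (exp x * cos y - (1 + x + (x * x - y * y) / 2)) with
    ((- / 2 - x * / 4) * (x * (y * y)) + (1 + x + x * x / 2) * e2 + e1 * cos y)
    by (unfold e1, e2; field).
  eapply Rle_trans; [apply Rabs_plus_le; [apply Rabs_plus_le|]; apply Rabs_mult_le; eassumption|].
  assert (0 <= H ^ 3) by now apply pow_le.
  simpl in *; lra. }
assert (A2 : Rabs (exp x * sin y - (y + x * y)) <= 10 * H ^ 3).
{ replace (exp x * sin y - (y + x * y)) with
    (/ 2 * (x * x * y) + (1 + x + x * x / 2) * e3 + e1 * sin y)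
    by (unfold e1, e3; field).
  eapply Rle_trans; [apply Rabs_plus_le; [apply Rabs_plus_le|]; apply Rabs_mult_le; eassumption|].
  assert (0 <= H ^ 3) by now apply pow_le.
  simpl in *; lra. }
apply Rle_trans with (20 * H ^ 3 * 2).
2: { right; ring. }
eapply Rle_trans; [apply Cmod_2Rmax|].
assert (s2 : sqrt 2 <= 2).
{ rewrite <- (sqrt_Rsqr 2) at 2 by lra; apply sqrt_le_1; unfold Rsqr; lra. }
rewrite Rmult_comm; apply Rmult_le_compat; [| apply sqrt_pos| |exact s2].
- eapply Rle_trans; [apply Rabs_pos|apply Rmax_l].
- assert (0 <= H ^ 3) by now apply pow_le.
  apply Rmax_lub; simpl.
  + match goal with |- Rabs ?t <= _ =>
      replace t with (exp x * cos y - (1 + x + (x * x - y * y) / 2)) by field end.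
    simpl in *; lra.
  + match goal with |- Rabs ?t <= _ =>
      replace t with (exp x * sin y - (y + x * y)) by field end.
    simpl in *; lra.
Qed.

(** Q is (e^h - 1) / h. It yields the expansion of [Cexp] at 0 and, being invertible near 0, also
    that of the logarithm. *)
Lemma Cexp_divided : exists Q, jet 2 Q (RtoC 0) /\ Q (RtoC 0) = RtoC 1 /\
  near (RtoC 0) (fun h => Cexp h = (1 + h * Q h)%C).
Proof.
set (r := fun h => ((Cexp h - 1 - h - RtoC (/ 2) * h ^ 2) / h ^ 3)%C).
set (s := fun h => (RtoC (/ 2) + h * r h)%C).
assert (e : forall h, Cexp h = (1 + h * (1 + h * s h))%C).
{ intros h; unfold s, r; destruct (Req_dec (Cmod h) 0) as [h0|h0].
  - apply Cmod_eq_0 in h0; subst h; rewrite Cexp_0; ring.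
  - assert (h <> RtoC 0) by (intros ->; now rewrite Cmod_0 in h0).
    simpl; field; assumption. }
exists (fun h => 1 + h * s h)%C; split; [|split].
- exists s; split.
  + exists r; split.
    * exists 40, 1; split; [lra|]; intros h hh.
      replace (h - RtoC 0)%C with h in hh by ring.
      unfold r; destruct (Req_dec (Cmod h) 0) as [h0|h0].
      -- apply Cmod_eq_0 in h0; subst h; rewrite Cexp_0.
         match goal with |- Cmod ?t <= _ => replace t with (RtoC 0) by (simpl; unfold Cdiv; ring) end.
         rewrite Cmod_0; lra.
      -- assert (hn : h <> RtoC 0) by (intros ->; now rewrite Cmod_0 in h0).
         assert (0 < Cmod h) by now apply Cmod_gt_0.
         rewrite Cmod_div, Cmod_pow by now apply Cpow_nz.
         apply Rle_div_l; [apply pow_lt; assumption|now apply Cexp_taylor2].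
    * exists 1; split; [lra|]; intros h _; unfold s; ring.
  + exists 1; split; [lra|]; intros h _; ring.
- ring.
- exists 1; split; [lra|]; intros h _; apply e.
Qed.

(** Additivity of the exponential transports the expansion from 0 to z. *)
Lemma jet_Cexp (z : C) : jet 3 Cexp z.
Proof.
destruct Cexp_divided as [Q [hQ [_ hE]]].
assert (h0 : jet 3 Cexp (RtoC 0)).
{ exists Q; split; [exact hQ|].
  apply near_imp with (2 := hE); intros u ->; rewrite Cexp_0; ring. }
apply jet_ext with (fun u => Cexp z * Cexp (u + - z))%C.
- exists 1; split; [lra|]; intros u _; rewrite <- Cexp_add; f_equal; ring.
- assert (hl : forall k, jet k (fun u => u + - z)%C z)
    by (intros; apply jet_add; [apply jet_id|apply jet_const]).
  apply jet_mul; [apply jet_const|].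
  apply (jet_comp 3 Cexp (fun u => u + - z)%C z); [apply jet_cont; auto| |auto].
  now replace (z + - z)%C with (RtoC 0) by ring.
Qed.

(** * The principal logarithm on the right half-plane *)

Definition Clog (y : C) : C := (ln (Cmod y), atan (Im y / Re y)).

Lemma atan_polar (y : C) : 0 < Re y ->
  y = (RtoC (Cmod y) * (cos (atan (Im y / Re y)), sin (atan (Im y / Re y))))%C.
Proof.
destruct y as [a b]; simpl; intros ha; unfold Re, Im; simpl.
assert (e : Cmod (a, b) = a * sqrt (1 + (b / a)²)).
{ unfold Cmod; simpl.
  rewrite <- (sqrt_Rsqr a) at 3 by lra; rewrite <- sqrt_mult_alt by apply Rle_0_sqr.
  f_equal; unfold Rsqr; field; lra. }
assert (hs : 0 < sqrt (1 + (b / a)²)) by (apply sqrt_lt_R0; pose proof (Rle_0_sqr (b / a)); lra).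
rewrite cos_atan, sin_atan, e; unfold Cmult, RtoC; simpl; f_equal; field; lra.
Qed.

Lemma Carg_atan (y : C) : 0 < Re y -> Carg y = atan (Im y / Re y).
Proof.
intros hy; rewrite (atan_polar y hy) at 1; apply Carg_unique.
- apply Cmod_gt_0; intros ->; simpl in hy; lra.
- pose proof (atan_bound (Im y / Re y)); pose proof PI_RGT_0; lra.
Qed.

Lemma Cexp_Clog (y : C) : 0 < Re y -> Cexp (Clog y) = y.
Proof.
intros hy; apply eq_trans with (2 := eq_sym (atan_polar y hy)).
assert (0 < Cmod y) by (apply Cmod_gt_0; intros ->; simpl in hy; lra).
unfold Cexp, Clog; simpl; rewrite exp_ln by assumption.
unfold Cmult, RtoC; simpl; f_equal; ring.
Qed.

Lemma near_of_continuous (g : C -> R) (z : C) (e : R) :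
  @continuous (prod_UniformSpace R_UniformSpace R_UniformSpace) R_UniformSpace g z ->
  0 < e -> near z (fun u => Rabs (g u - g z) < e).
Proof.
intros hg he.
destruct (hg (ball (g z) (mkposreal e he)) (locally_ball _ _)) as [d hd].
exists d; split; [apply cond_pos|]; intros u hu; apply hd.
pose proof (Rmax_Cmod (u - z)%C) as hm.
split; (eapply Rle_lt_trans; [|exact hu]); (eapply Rle_trans; [|exact hm]).
- apply Rmax_l.
- apply Rmax_r.
Qed.

Lemma continuous_ln_Cmod (y : C) : 0 < Re y ->
  @continuous (prod_UniformSpace R_UniformSpace R_UniformSpace) R_UniformSpace
    (fun u => ln (Cmod u)) y.
Proof.
intros hy.
assert (hp : 0 < Cmod y) by (apply Cmod_gt_0; intros ->; simpl in hy; lra).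
apply (continuous_comp (U := prod_UniformSpace R_UniformSpace R_UniformSpace) Cmod ln).
- unfold Cmod.
  apply (continuous_comp (U := prod_UniformSpace R_UniformSpace R_UniformSpace)
    (fun u : R * R => fst u ^ 2 + snd u ^ 2) sqrt).
  + apply (continuous_plus (U := prod_UniformSpace R_UniformSpace R_UniformSpace)
      (V := R_NormedModule)).
    * apply (continuous_comp (U := prod_UniformSpace R_UniformSpace R_UniformSpace)
        (fun u : R * R => fst u) (fun x => x ^ 2)); [apply continuous_fst|].
      apply continuity_pt_filterlim; reg.
    * apply (continuous_comp (U := prod_UniformSpace R_UniformSpace R_UniformSpace)
        (fun u : R * R => snd u) (fun x => x ^ 2)); [apply continuous_snd|].
      apply continuity_pt_filterlim; reg.
  + apply continuity_pt_filterlim, continuity_pt_sqrt.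
    pose proof (pow2_ge_0 (fst y)); pose proof (pow2_ge_0 (snd y)); lra.
- apply continuity_pt_filterlim, derivable_continuous_pt.
  exists (/ Cmod y); now apply derivable_pt_lim_ln.
Qed.

Lemma continuous_atan_quot (y : C) : 0 < Re y ->
  @continuous (prod_UniformSpace R_UniformSpace R_UniformSpace) R_UniformSpace
    (fun u => atan (Im u / Re u)) y.
Proof.
intros hy.
apply (continuous_comp (U := prod_UniformSpace R_UniformSpace R_UniformSpace)
  (fun u : R * R => snd u / fst u) atan).
- apply (continuous_mult (U := prod_UniformSpace R_UniformSpace R_UniformSpace)
    (K := R_AbsRing) (fun u : R * R => snd u) (fun u : R * R => / fst u)).
  + apply continuous_snd.
  + apply (continuous_comp (U := prod_UniformSpace R_UniformSpace R_UniformSpace)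
      (fun u : R * R => fst u) Rinv); [apply continuous_fst|].
    apply continuous_Rinv; unfold Re in hy; lra.
- apply continuity_pt_filterlim, derivable_continuous_pt, derivable_pt_atan.
Qed.

Lemma near_Re_pos (y : C) : 0 < Re y -> near y (fun u => 0 < Re u).
Proof.
intros hy; exists (Re y); split; [exact hy|]; intros u hu.
pose proof (re_le_Cmod (u - y)) as h.
apply Rle_lt_trans with (1 := h), Rabs_lt_between in hu.
simpl in hu; unfold Re in *; lra.
Qed.

Lemma Clog_cont (y : C) : 0 < Re y -> cont_at Clog y.
Proof.
intros hy e he; assert (he' : 0 < e / 2) by lra.
apply near_imp with (2 := near_and _ _ _
  (near_of_continuous _ y _ (continuous_ln_Cmod y hy) he')
  (near_of_continuous _ y _ (continuous_atan_quot y hy) he')).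
intros u [h1 h2]; apply Cmod_lt_of_components; [exact h1|exact h2].
Qed.

(* With l = Clog u - Clog y one has u / y = Cexp l = 1 + l Q(l), so that
   the divided difference of Clog is 1 / (y Q(l)): each order of expansion
   of Clog yields the next one. *)
Lemma jet_Clog (y : C) : 0 < Re y -> jet 3 Clog y.
Proof.
intros hy.
assert (hy0 : y <> RtoC 0) by (intros ->; simpl in hy; lra).
destruct Cexp_divided as [Q [hQ [hQ0 hE]]].
assert (hc : cont_at Clog y) by now apply Clog_cont.
set (l := fun u => (Clog u + - Clog y)%C).
assert (hly : l y = RtoC 0) by (unfold l; ring).
assert (hlc : cont_at l y).
{ intros e he; apply near_imp with (2 := hc e he); intros u hu; unfold l.
  now replace (Clog u + - Clog y - (Clog y + - Clog y))%C with (Clog u - Clog y)%C by ring. }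
assert (hQc : cont_at Q (l y)) by (rewrite hly; apply jet_cont, jet_pred, hQ).
assert (hQl : cont_at (fun u => Q (l u)) y).
{ intros e he; exact (near_comp l y _ hlc (hQc e he)). }
assert (step : forall k, (k <= 2)%nat -> jet k Clog y -> jet (S k) Clog y).
{ intros k hk hj; exists (fun u => / y * / Q (l u))%C; split.
  - apply jet_mul; [apply jet_const|]; apply jet_inv; [exact hQl| |].
    + rewrite hly, hQ0; intros h; injection h; lra.
    + apply jet_comp; [exact hlc| |].
      * rewrite hly; now apply (jet_le k 2).
      * apply jet_add; [exact hj|apply jet_const].
  - rewrite <- hly in hE.
    assert (hn : near y (fun u => Q (l u) <> RtoC 0)).
    { apply near_imp with (fun u => 0 < Cmod (Q (l u))); [intros u; apply Cmod_gt_0|].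
      apply (near_comp (fun u => Q (l u)) y (fun v => 0 < Cmod v) hQl), near_Cmod_gt.
      rewrite hly, hQ0, Cmod_1; lra. }
    apply near_imp with (2 := near_and _ _ _ (near_and _ _ _ (near_Re_pos y hy) hn)
      (near_comp l y _ hlc hE)).
    intros u [[h1 h2] h3].
    assert (e : (u = y * Cexp (l u))%C).
    { rewrite <- (Cexp_Clog u h1) at 1; rewrite <- (Cexp_Clog y hy) at 1.
      rewrite <- Cexp_add; f_equal; unfold l; ring. }
    rewrite h3 in e.
    replace (u - y)%C with (y * (l u * Q (l u)))%C by (rewrite e at 3; ring).
    replace (Clog u) with (Clog y + l u)%C by (unfold l; ring).
    field; split; assumption. }
apply step; [lia|]; apply step; [lia|]; apply step; [lia|].
exists (Cmod (Clog y) + 1).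
apply near_imp with (2 := hc 1 Rlt_0_1); intros u hu.
pose proof (Cmod_triangle (Clog u - Clog y) (Clog y)) as ht.
replace (Clog u - Clog y + Clog y)%C with (Clog u) in ht by ring; lra.
Qed.

(** * The conformal map tanh (s / 2) from the strip |Im s| < PI/2 to the unit disk *)

Definition Ctanh_half (s : C) : C := ((Cexp s - 1) * / (Cexp s + 1))%C.

Lemma Cexp_plus1_neq0 (s : C) : 0 < cos (Im s) -> (Cexp s + 1)%C <> RtoC 0.
Proof.
intros hs h; apply (f_equal Re) in h; simpl in h.
pose proof (exp_pos (Re s)); unfold Re in *; simpl in *; nra.
Qed.

Lemma jet_Ctanh_half (s : C) : 0 < cos (Im s) -> jet 3 Ctanh_half s.
Proof.
intros hs; apply jet_mul.
- apply (jet_add 3 Cexp (fun _ => - (1))%C); [apply jet_Cexp|apply jet_const].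
- assert (hj : jet 3 (fun u => Cexp u + 1)%C s)
    by (apply jet_add; [apply jet_Cexp|apply jet_const]).
  apply jet_inv; [apply jet_cont, (jet_le 1 3); [lia|exact hj]|now apply Cexp_plus1_neq0|exact hj].
Qed.

Lemma Cexp_pm1_sqr (s : C) :
  Cmod (Cexp s - 1) ^ 2 = exp (Re s) ^ 2 - 2 * exp (Re s) * cos (Im s) + 1 /\
  Cmod (Cexp s + 1) ^ 2 = exp (Re s) ^ 2 + 2 * exp (Re s) * cos (Im s) + 1.
Proof.
pose proof (sin2_cos2 (Im s)) as h; unfold Rsqr in h.
rewrite !Cmod2_alt; unfold Cexp, Re, Im; simpl.
set (x := exp (fst s)) in *; set (c := cos (snd s)) in *; unfold Im in h.
fold c in h; set (d := sin (snd s)) in *.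
split.
- replace (x * (x * 1) - 2 * x * c + 1) with (x * x * (d * d + c * c) - 2 * x * c + 1)
    by (rewrite h; ring).
  ring.
- replace (x * (x * 1) + 2 * x * c + 1) with (x * x * (d * d + c * c) + 2 * x * c + 1)
    by (rewrite h; ring).
  ring.
Qed.

(** |e^s + 1|^2 - |e^s - 1|^2 = 4 e^(Re s) cos (Im s). *)
Lemma Ctanh_half_le1 (s : C) : 0 < cos (Im s) -> Cmod (Ctanh_half s) <= 1.
Proof.
intros hs; pose proof (Cexp_plus1_neq0 s hs) as hn.
assert (hp : 0 < Cmod (Cexp s + 1)) by now apply Cmod_gt_0.
unfold Ctanh_half; rewrite Cmod_mult, Cmod_inv by exact hn.
apply Rle_div_l; [exact hp|]; rewrite Rmult_1_l.
destruct (Cexp_pm1_sqr s) as [e1 e2].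
pose proof (exp_pos (Re s)); pose proof (Cmod_ge_0 (Cexp s - 1)).
apply Rnot_lt_le; intros hlt; simpl in *; nra.
Qed.

(** With x = e^(Re s) the assumption reads (1 - r^2) (x^2 + 1) <= 2 x (1 + r^2) cos (Im s). Since
    x^2 + 1 >= 2 x, this gives cos (Im s) >= (1 - r^2) / (1 + r^2) = cos (2 atan r), and cos
    decreases on the range in question. *)
Lemma Ctanh_half_strip (s : C) (r : R) : Rabs (Im s) < PI / 2 -> 0 <= r < 1 ->
  Cmod (Ctanh_half s) <= r -> Rabs (Im s) <= 2 * atan r.
Proof.
intros hs hr hle.
assert (hcos : 0 < cos (Im s)).
{ apply Rabs_lt_between in hs; apply cos_gt_0; lra. }
pose proof (Cexp_plus1_neq0 s hcos) as hn.
assert (hp : 0 < Cmod (Cexp s + 1)) by now apply Cmod_gt_0.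
unfold Ctanh_half in hle; rewrite Cmod_mult, Cmod_inv in hle by exact hn.
apply Rle_div_l in hle; [|exact hp].
assert (hsq : Cmod (Cexp s - 1) ^ 2 <= r ^ 2 * Cmod (Cexp s + 1) ^ 2).
{ rewrite <- Rpow_mult_distr; apply pow_incr; split; [apply Cmod_ge_0|exact hle]. }
destruct (Cexp_pm1_sqr s) as [e1 e2]; rewrite e1, e2 in hsq; clear e1 e2.
pose proof (exp_pos (Re s)) as hx; set (x := exp (Re s)) in *; clearbody x.
assert (hc : 1 - r ^ 2 <= cos (Im s) * (1 + r ^ 2)).
{ apply Rmult_le_reg_l with (2 * x); [lra|].
  assert (0 <= (1 - r ^ 2) * (x - 1) ^ 2) by (apply Rmult_le_pos; [simpl; nra|apply pow2_ge_0]).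
  simpl in *; nra. }
assert (ha : cos (2 * atan r) * (1 + r ^ 2) = 1 - r ^ 2).
{ rewrite cos_2a, cos_atan, sin_atan.
  assert (hs1 : 0 < sqrt (1 + r²)) by (apply sqrt_lt_R0; unfold Rsqr; nra).
  assert (hs2 : sqrt (1 + r²) * sqrt (1 + r²) = 1 + r²) by (apply sqrt_sqrt; unfold Rsqr; nra).
  apply Rmult_eq_reg_r with (sqrt (1 + r²) * sqrt (1 + r²)); [|nra].
  field_simplify; [|lra]; simpl; unfold Rsqr in *; rewrite ?hs2; nra. }
assert (hat0 : 0 <= atan r).
{ destruct (Req_dec r 0) as [->|hr0]; [rewrite atan_0; lra|].
  rewrite <- atan_0; left; apply atan_increasing; lra. }
assert (hat1 : atan r < PI / 4) by (rewrite <- atan_1; apply atan_increasing; lra).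
apply Rnot_lt_le; intros hlt.
assert (hd : cos (Rabs (Im s)) < cos (2 * atan r)) by (apply cos_decreasing_1; lra).
assert (he : cos (Rabs (Im s)) = cos (Im s)).
{ unfold Rabs; destruct (Rcase_abs (Im s)); [apply cos_neg|reflexivity]. }
rewrite he in hd; assert (0 < 1 + r ^ 2) by (simpl; nra); nra.
Qed.

(** * Functions with values in a sector *)

Lemma sector_estimate (p : C -> C) (n : nat) (a0 mu R0 M : R) :
  (0 < n)%nat -> 0 < a0 -> 0 < mu -> 0 < R0 ->
  (forall z, Cmod z < R0 -> jet 3 p z) ->
  (forall z, Cmod z < R0 -> 0 < Re (p z) /\ Rabs (atan (Im (p z) / Re (p z))) < PI / 2 * mu) ->
  near (RtoC 0) (fun u => Cmod (p u - a0) <= M * Cmod u ^ n) ->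
  forall z, Cmod z < R0 ->
  Rabs (atan (Im (p z) / Re (p z))) <= 2 * mu * atan ((Cmod z / R0) ^ n).
Proof.
intros hn ha0 hmu hR hj hsec hord.
(* S y is log (y / a0) / mu. As a0 is a positive real, its logarithm is real and does not affect the
   imaginary part. *)
set (S := fun y => ((Clog y + - RtoC (ln a0)) * RtoC (/ mu))%C).
assert (hImS : forall y, Im (S y) = atan (Im y / Re y) / mu).
{ intros y; unfold S, Clog, Cmult, Im; simpl; unfold Im; field; lra. }
assert (hjS : forall y, 0 < Re y -> jet 3 S y).
{ intros y hy; apply jet_mul; [|apply jet_const].
  apply jet_add; [now apply jet_Clog|apply jet_const]. }
assert (hstrip : forall y, Rabs (atan (Im y / Re y)) < PI / 2 * mu -> Rabs (Im (S y)) < PI / 2).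
{ intros y hy; rewrite hImS; unfold Rdiv; rewrite Rabs_mult, (Rabs_pos_eq (/ mu)).
  - apply Rmult_lt_reg_r with mu; [exact hmu|].
    rewrite Rmult_assoc, Rinv_l by lra; lra.
  - left; now apply Rinv_0_lt_compat. }
assert (hcos : forall s, Rabs (Im s) < PI / 2 -> 0 < cos (Im s)).
{ intros s hs; apply Rabs_lt_between in hs; apply cos_gt_0; lra. }
assert (hjW : forall y, 0 < Re y -> Rabs (atan (Im y / Re y)) < PI / 2 * mu ->
  jet 3 (fun v => Ctanh_half (S v)) y).
{ intros y hy hs; apply jet_comp; auto using jet_Ctanh_half.
  apply jet_cont, (jet_le 1 3); [lia|auto]. }
assert (h0 : Cmod (RtoC 0) < R0) by now rewrite Cmod_0.
assert (hp0 : p (RtoC 0) = RtoC a0) by exact (order_bound_at_0 p a0 M n hn hord).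
assert (hcp : forall z, Cmod z < R0 -> cont_at p z).
{ intros z hz; apply jet_cont, (jet_le 1 3); [lia|auto]. }
(* The map [Ctanh_half (S y)] vanishes at y = a0; its divided difference there is bounded and
   carries the order n of p - a0 over to w. *)
assert (hordW : exists A, near (RtoC 0) (fun u => Cmod (Ctanh_half (S (p u))) <= A * Cmod u ^ n)).
{ destruct (hsec _ h0) as [q1 q2]; rewrite hp0 in q1, q2.
  destruct (hjW (RtoC a0) q1 q2) as [q [hq he]].
  apply (jet_le 0 2) in hq; [|lia]; destruct hq as [K hK].
  assert (hK0 : 0 <= K) by (eapply Rle_trans; [apply Cmod_ge_0|exact (near_self _ _ hK)]).
  assert (hS0 : S (RtoC a0) = RtoC 0).
  { unfold S, Clog; rewrite Cmod_R, Rabs_pos_eq by lra.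
    unfold RtoC, Re, Im, Cmult, Cplus, Copp; simpl.
    replace (0 / a0) with 0 by (field; lra); rewrite atan_0; f_equal; ring. }
  exists (K * M); rewrite <- hp0 in he, hK.
  apply near_imp with (2 := near_and _ _ _ hord (near_and _ _ _
    (near_comp p _ _ (hcp _ h0) hK) (near_comp p _ _ (hcp _ h0) he))).
  intros u [h1 [h2 h3]]; rewrite h3, hp0, hS0.
  unfold Ctanh_half; rewrite Cexp_0.
  replace ((1 - 1) * / (1 + 1) + (p u - a0) * q (p u))%C with (q (p u) * (p u - a0))%C by ring.
  rewrite Cmod_mult, Rmult_assoc; apply Rmult_le_compat; auto using Cmod_ge_0. }
destruct hordW as [A hA].
intros z hz; destruct (hsec z hz) as [hz1 hz2].
assert (hq : 0 <= Cmod z / R0 < 1).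
{ split; [apply Rdiv_le_0_compat; [apply Cmod_ge_0|exact hR]|apply Rlt_div_l; lra]. }
assert (hb : Rabs (Im (S (p z))) <= 2 * atan ((Cmod z / R0) ^ n)).
{ apply Ctanh_half_strip; [auto| |].
  - split; [apply pow_le; lra|].
    destruct n as [|n']; [lia|].
    apply Rle_lt_trans with (Cmod z / R0); [|lra].
    assert ((Cmod z / R0) ^ n' <= 1) by (rewrite <- (pow1 n'); apply pow_incr; lra).
    simpl; nra.
  - apply (schwarz_order (fun u => Ctanh_half (S (p u))) n R0 A hn hR); [| |exact hA|exact hz].
    + intros u hu; destruct (hsec u hu).
      apply (jet_comp 3 (fun v => Ctanh_half (S v)) p u); auto.
    + intros u hu; destruct (hsec u hu); auto using Ctanh_half_le1. }
rewrite hImS in hb; unfold Rdiv in hb at 1; rewrite Rabs_mult, (Rabs_pos_eq (/ mu)) in hb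
  by (left; now apply Rinv_0_lt_compat).
apply (Rmult_le_compat_r mu) in hb; [|lra].
rewrite Rmult_assoc, Rinv_l in hb by lra; lra.
Qed.

(** * Derivatives at a point of contact with the sector *)

Lemma C_derive_expand (p : C -> C) (z : C) (e : R) :
  @ex_derive C_AbsRing C_NormedModule p z -> 0 < e ->
  near z (fun u => Cmod (p u - p z - (u - z) * C_derive p z) <= e * Cmod (u - z)).
Proof.
intros hd he; apply (C_derive_correct p z z) in hd; destruct hd as [_ hd].
specialize (hd z (fun P hP => hP) (mkposreal e he)).
destruct hd as [d hd]; exists d; split; [apply cond_pos|]; intros u hu.
exact (hd u hu).
Qed.

Lemma line_derive (p : C -> C) (z l c : C) :
  (forall e, 0 < e -> near z (fun u => Cmod (p u - p z - (u - z) * l) <= e * Cmod (u - z))) ->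
  is_derive (fun t : R => Re (p (z + RtoC t * c)%C)) 0 (Re (l * c)) /\
  is_derive (fun t : R => Im (p (z + RtoC t * c)%C)) 0 (Im (l * c)).
Proof.
intros hl; pose proof (Cmod_ge_0 c) as hc.
assert (key : forall e, 0 < e -> exists d : posreal, forall t, t <> 0 -> Rabs t < d ->
  Cmod ((p (z + RtoC t * c)%C - p z) / RtoC t - l * c) < e).
{ intros e he.
  destruct (hl (e / (Cmod c + 1))) as [d [hd h]]; [apply Rdiv_lt_0_compat; lra|].
  assert (hd' : 0 < d / (Cmod c + 1)) by (apply Rdiv_lt_0_compat; lra).
  exists (mkposreal _ hd'); simpl; intros t ht0 ht.
  assert (htn : RtoC t <> RtoC 0) by (intros q; apply ht0; now injection q).
  assert (htp : 0 < Rabs t) by now apply Rabs_pos_lt.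
  specialize (h (z + RtoC t * c)%C).
  replace (z + RtoC t * c - z)%C with (RtoC t * c)%C in h by ring.
  rewrite Cmod_mult, Cmod_R in h.
  assert (hlt : Rabs t * Cmod c < d).
  { replace d with (d / (Cmod c + 1) * (Cmod c + 1)) by (field; lra); nra. }
  specialize (h hlt).
  replace ((p (z + RtoC t * c)%C - p z) / RtoC t - l * c)%C with
    ((p (z + RtoC t * c)%C - p z - RtoC t * c * l) / RtoC t)%C by (field; assumption).
  rewrite Cmod_div, Cmod_R by assumption.
  apply Rlt_div_l; [exact htp|].
  eapply Rle_lt_trans; [exact h|].
  replace (e / (Cmod c + 1) * (Rabs t * Cmod c)) with (e * Rabs t * (Cmod c / (Cmod c + 1)))
    by (field; lra).
  assert (Cmod c / (Cmod c + 1) < 1) by (apply Rlt_div_l; lra).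
  assert (0 < e * Rabs t) by now apply Rmult_lt_0_compat.
  nra. }
split; apply is_derive_Reals; intros e he; destruct (key e he) as [d hd]; exists d;
  intros t ht0 ht; (eapply Rle_lt_trans; [|exact (hd t ht0 ht)]);
  replace (z + RtoC 0 * c)%C with z by ring; rewrite Rplus_0_l.
- eapply Rle_trans; [|apply re_le_Cmod]; right; f_equal.
  unfold Re; simpl; field; exact ht0.
- eapply Rle_trans; [|eapply Rle_trans; [apply Rmax_r|apply Rmax_Cmod]]; right; f_equal.
  unfold Im; simpl; field; exact ht0.
Qed.

Lemma derive_nonneg_right (f : R -> R) (l d : R) : is_derive f 0 l -> f 0 = 0 -> 0 < d ->
  (forall t, 0 < t < d -> 0 <= f t) -> 0 <= l.
Proof.
intros hf h0 hd hpos; apply is_derive_Reals in hf.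
apply Rnot_lt_le; intros hl; destruct (hf (- l)) as [e he]; [lra|].
assert (ht : 0 < Rmin d e / 2) by (assert (0 < Rmin d e) by (apply Rmin_pos; [lra|apply cond_pos]); lra).
assert (ht1 : Rmin d e / 2 < d) by (pose proof (Rmin_l d e); lra).
assert (ht2 : Rmin d e / 2 < e) by (pose proof (Rmin_r d e); lra).
set (t := Rmin d e / 2) in *.
specialize (he t ltac:(lra) ltac:(rewrite Rabs_pos_eq; lra)).
rewrite Rplus_0_l, h0, Rminus_0_r in he; apply Rabs_lt_between in he.
assert (0 <= f t / t) by (apply Rdiv_le_0_compat; [apply hpos|]; lra).
lra.
Qed.

(* First-order comparison at the boundary point z0, along z0 (1 + t (-1 + iy)). *)
Lemma boundary_derivative (p : C -> C) (n : nat) (mu s : R) (z0 l : C) :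
  z0 <> RtoC 0 -> 0 < Re (p z0) ->
  (forall e, 0 < e -> near z0 (fun u => Cmod (p u - p z0 - (u - z0) * l) <= e * Cmod (u - z0))) ->
  s * atan (Im (p z0) / Re (p z0)) = PI / 2 * mu ->
  (forall z, Cmod z < Cmod z0 ->
    s * atan (Im (p z) / Re (p z)) <= 2 * mu * atan ((Cmod z / Cmod z0) ^ n)) ->
  forall y, INR n * mu <= s * Im (z0 * l / p z0 * (1, (- y)%R)).
Proof.
intros hz0 hre hl htouch hin y.
assert (hzp : 0 < Cmod z0) by now apply Cmod_gt_0.
set (c := (z0 * (-1, y))%C).
destruct (line_derive p z0 l c hl) as [hRe hIm].
set (f1 := fun t : R => Re (p (z0 + RtoC t * c)%C)) in *.
set (f2 := fun t : R => Im (p (z0 + RtoC t * c)%C)) in *.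
assert (ez : (z0 + RtoC 0 * c)%C = z0) by ring.
assert (e1 : f1 0 = Re (p z0)) by (unfold f1; now rewrite ez).
assert (e2 : f2 0 = Im (p z0)) by (unfold f2; now rewrite ez).
(* m t = |1 + t (-1 + i y)| is the modulus relative to |z0|; its derivative at 0 is -1 for every
   y. *)
set (m := fun t => sqrt ((1 - t) ^ 2 + (t * y) ^ 2)).
assert (m0 : m 0 = 1).
{ unfold m; replace ((1 - 0) ^ 2 + (0 * y) ^ 2) with 1 by ring; apply sqrt_1. }
assert (hm : forall t, Cmod (z0 + RtoC t * c) = Cmod z0 * m t).
{ intros t; unfold c.
  replace (z0 + RtoC t * (z0 * (-1, y)))%C with (z0 * (1 + RtoC t * (-1, y)))%C by ring.
  rewrite Cmod_mult; f_equal; unfold Cmod, m; simpl; f_equal; ring. }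
(* D vanishes at 0, where 2 mu atan 1 = mu PI/2 meets the contact condition, and is nonnegative for
   small t > 0. *)
set (D := fun t => 2 * mu * atan (m t ^ n) - s * atan (f2 t / f1 t)).
set (d1 := Re (l * c)) in *; set (d2 := Im (l * c)) in *.
set (P1 := Re (p z0)) in *; set (P2 := Im (p z0)) in *.
assert (hmd : is_derive m 0 (-1)).
{ unfold m; auto_derive.
  - replace ((1 + - 0) * ((1 + - 0) * 1) + 0 * y * (0 * y * 1)) with 1 by ring; lra.
  - replace ((1 + - 0) * ((1 + - 0) * 1) + 0 * y * (0 * y * 1)) with 1 by ring.
    rewrite sqrt_1; field. }
assert (hP : 0 < P1 ^ 2 + P2 ^ 2) by (simpl; nra).
assert (hat : is_derive (fun t => atan (f2 t / f1 t)) 0 ((d2 * P1 - P2 * d1) / (P1 ^ 2 + P2 ^ 2))).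
{ evar_last.
  - apply (is_derive_comp atan (fun t => f2 t / f1 t)).
    + apply is_derive_Reals, derivable_pt_lim_atan.
    + apply is_derive_div; [exact hIm|exact hRe|rewrite e1; lra].
  - rewrite e1, e2; unfold scal; simpl; unfold mult; simpl; unfold Rsqr.
    field; simpl in hP; repeat split; nra. }
assert (hmn : is_derive (fun t => atan (m t ^ n)) 0 (- INR n / 2)).
{ evar_last.
  - apply (is_derive_comp atan (fun t => m t ^ n)).
    + apply is_derive_Reals, derivable_pt_lim_atan.
    + apply is_derive_pow; exact hmd.
  - rewrite m0, !pow1; unfold scal; simpl; unfold mult; simpl; unfold Rsqr; field. }
assert (hD : is_derive D 0 (- (INR n * mu) - s * ((d2 * P1 - P2 * d1) / (P1 ^ 2 + P2 ^ 2)))).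
{ evar_last.
  - apply (is_derive_minus (K := R_AbsRing) (V := R_NormedModule)).
    + apply is_derive_scal; exact hmn.
    + apply is_derive_scal; exact hat.
  - unfold minus, plus, opp; simpl; field; simpl in hP; lra. }
assert (hD0 : 0 <= - (INR n * mu) - s * ((d2 * P1 - P2 * d1) / (P1 ^ 2 + P2 ^ 2))).
(* The second bound on t ensures (1 - t)^2 + (t y)^2 < 1, so the path stays inside |z| < |z0|. *)
{ apply (derive_nonneg_right D _ (Rmin 1 (1 / (1 + y ^ 2))) hD).
  - unfold D; rewrite m0, pow1, atan_1, e1, e2, htouch; field.
  - apply Rmin_pos; [lra|]; apply Rdiv_lt_0_compat; [lra|]; simpl; nra.
  - intros t [ht1 ht2].
    assert (hta : t < 1) by (eapply Rlt_le_trans; [exact ht2|apply Rmin_l]).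
    assert (htb : t * (1 + y ^ 2) < 1).
    { assert (0 < 1 + y ^ 2) by (simpl; nra).
      apply Rlt_div_r; [assumption|].
      eapply Rlt_le_trans; [exact ht2|apply Rmin_r]. }
    assert (hmt : m t < 1).
    { rewrite <- sqrt_1; unfold m; apply sqrt_lt_1; [|lra|].
      - pose proof (pow2_ge_0 (1 - t)); pose proof (pow2_ge_0 (t * y)); lra.
      - simpl in *; nra. }
    specialize (hin (z0 + RtoC t * c)%C); rewrite hm in hin.
    specialize (hin ltac:(nra)).
    replace (Cmod z0 * m t / Cmod z0) with (m t) in hin by (field; lra).
    unfold D, f1, f2; lra. }
assert (hpn : p z0 <> RtoC 0) by (intros h; unfold P1 in hre; rewrite h in hre; simpl in hre; lra).
(* The derivative of the argument along c is Im (l c / p z0), and c = - z0 (1 - i y). *)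
assert (hzeta : Im (z0 * l / p z0 * (1, (- y)%R)) = - ((d2 * P1 - P2 * d1) / (P1 ^ 2 + P2 ^ 2))).
{ unfold d1, d2, c, P1, P2 in *; clear - hP.
  destruct z0 as [a b], l as [u v]; destruct (p (a, b)) as [g h].
  unfold Re, Im, Cdiv, Cinv, Cmult in *; simpl in *; field; lra. }
rewrite hzeta; lra.
Qed.

(** 1 - i b has argument - atan b. Both angles lie in (-PI/2, PI/2), so their sum is the principal
    argument without wrapping. *)
Lemma Carg_rotated (w : C) (b : R) : 0 < Re w ->
  (w * (1, (- b)%R))%C <> RtoC 0 /\ Carg (w * (1, (- b)%R)) = atan (Im w / Re w) - atan b.
Proof.
intros hw.
assert (h1 : 0 < Re (1, (- b)%R)) by (simpl; lra).
pose proof (atan_polar w hw) as e; pose proof (atan_polar _ h1) as e'.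
replace (Im (1, (- b)%R) / Re (1, (- b)%R)) with (- b) in e' by (simpl; field).
assert (n1 : 0 < Cmod w) by (apply Cmod_gt_0; intros ->; simpl in hw; lra).
assert (n2 : 0 < Cmod (1, (- b)%R)) by (apply Cmod_gt_0; intros h; injection h; lra).
split.
- apply Cmod_gt_0; rewrite Cmod_mult; now apply Rmult_lt_0_compat.
- set (x := atan (Im w / Re w)) in *.
  assert (e3 : (w * (1, (- b)%R))%C
    = (RtoC (Cmod w * Cmod (1, (- b)%R)) * (cos (x - atan b), sin (x - atan b)))%C).
  { rewrite e at 1; rewrite e' at 1; rewrite atan_opp.
    unfold Rminus; rewrite cos_plus, sin_plus.
    unfold RtoC, Cmult; simpl; f_equal; ring. }
  rewrite e3; apply Carg_unique; [now apply Rmult_lt_0_compat|].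
  unfold x; pose proof (atan_bound (Im w / Re w)); pose proof (atan_bound b); lra.
Qed.

(** T Re w - |Im w| is positive exactly on the open sector of half-angle atan T when T > 0. Unlike
    the argument it is Lipschitz everywhere, also at 0 and on the negative axis, so it can detect
    the exit from the sector. *)
Lemma sector_gap_lip (T : R) (u y : C) : 0 <= T ->
  Rabs ((T * Re u - Rabs (Im u)) - (T * Re y - Rabs (Im y))) <= (T + 1) * Cmod (u - y).
Proof.
intros hT.
pose proof (re_le_Cmod (u - y)) as h1.
assert (h2 : Rabs (Im u - Im y) <= Cmod (u - y)).
{ eapply Rle_trans; [|apply Rmax_Cmod]; apply (Rmax_r _ (Rabs (snd (u - y)%C))). }
assert (h1' : Rabs (Re u - Re y) <= Cmod (u - y)) by exact h1.
pose proof (Rabs_triang_inv2 (Im u) (Im y)) as h3.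
apply Rabs_le_between in h1'.
assert (h4 : Rabs (Rabs (Im u) - Rabs (Im y)) <= Cmod (u - y)) by lra.
apply Rabs_le_between in h4; apply Rabs_le_between; nra.
Qed.

Lemma atan_lt_of_sector (w : C) (t : R) : 0 < t < PI / 2 ->
  Rabs (Im w) < tan t * Re w -> 0 < Re w /\ Rabs (atan (Im w / Re w)) < t.
Proof.
intros ht h.
assert (hT : 0 < tan t) by (apply tan_gt_0; lra).
assert (hr : 0 < Re w) by (pose proof (Rabs_pos (Im w)); nra).
split; [exact hr|].
apply Rabs_lt_between in h.
rewrite <- (atan_tan t) by lra; apply Rabs_lt_between; rewrite <- atan_opp.
split; apply atan_increasing; [apply Rlt_div_r|apply Rlt_div_l]; lra.
Qed.

(** The sign s tells which side of the sector is touched. With z0 p'(z0) / p(z0) = al + i b, the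
    boundary comparison reads n mu <= s (b - al y) for all real y; an affine function bounded below
    is constant, so al = 0. *)
Lemma nunokawa (p : C -> C) (n : nat) (a0 mu M s : R) (z0 : C) :
  (0 < n)%nat -> 0 < a0 -> 0 < mu -> s * s = 1 -> z0 <> RtoC 0 ->
  (forall z, Cmod z < Cmod z0 -> jet 3 p z) ->
  @ex_derive C_AbsRing C_NormedModule p z0 ->
  (forall z, Cmod z < Cmod z0 ->
    0 < Re (p z) /\ Rabs (atan (Im (p z) / Re (p z))) < PI / 2 * mu) ->
  near (RtoC 0) (fun u => Cmod (p u - a0) <= M * Cmod u ^ n) ->
  0 < Re (p z0) -> s * atan (Im (p z0) / Re (p z0)) = PI / 2 * mu ->
  exists b, (z0 * C_derive p z0 / p z0)%C = (0, b) /\ INR n * mu <= s * b.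
Proof.
intros hn ha0 hmu hs hz0 hj hd hsec hord hre htouch.
assert (hzp : 0 < Cmod z0) by now apply Cmod_gt_0.
pose proof (sector_estimate p n a0 mu (Cmod z0) M hn ha0 hmu hzp hj hsec hord) as hest.
assert (hbd : forall y, INR n * mu <= s * Im (z0 * C_derive p z0 / p z0 * (1, (- y)%R))).
{ apply boundary_derivative; auto using C_derive_expand.
  intros z hz; eapply Rle_trans; [|apply hest; exact hz].
  eapply Rle_trans; [apply Rle_abs|]; rewrite Rabs_mult.
  assert (hs1 : Rabs s <= 1) by (apply Rabs_le_between; nra).
  pose proof (Rabs_pos (atan (Im (p z) / Re (p z)))); nra. }
set (ze := (z0 * C_derive p z0 / p z0)%C) in *; clearbody ze.
destruct ze as [al b].
assert (hbd' : forall y, INR n * mu <= s * (b - al * y)).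
{ intros y; specialize (hbd y); simpl in hbd.
  replace (b - al * y) with (al * - y + b * 1) by ring; exact hbd. }
assert (hpos : 0 < INR n * mu) by (apply Rmult_lt_0_compat; [apply lt_0_INR|]; assumption).
assert (hal : al = 0).
{ destruct (Req_dec al 0) as [h|h]; [exact h|exfalso].
  specialize (hbd' (b / al)).
  replace (b - al * (b / al)) with 0 in hbd' by (field; exact h); lra. }
subst al; exists b; split; [reflexivity|].
specialize (hbd' 0); rewrite Rmult_0_l, Rminus_0_r in hbd'; exact hbd'.
Qed.

Theorem theorem3 (n : nat) (a0 mu : R) (p : C -> C)
  (hn : (2 <= n)%nat)
  (ha0 : 0 < a0)
  (hmu0 : 0 < mu)
  (hmu : mu <= sqrt ((2 * INR n - PI) / (INR n ^ 2 * PI)))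
  (hmu1 : sqrt ((2 * INR n - PI) / (INR n ^ 2 * PI)) < 1)
  (hp : classH (RtoC a0) n p)
  (hp0 : forall z : C, unit_disk z -> p z <> RtoC 0)
  (harg : forall z : C, unit_disk z ->
     abs_arg_lt (p z - z * C_derive p z)%C (atan (INR n * mu) - PI / 2 * mu)) :
  classSTH (RtoC a0) n mu p.
Proof.
split; [exact hp|].
destruct hp as [han [a [ea0 [ha hser]]]].
assert (hsum : forall u, Cmod u < 1 -> sums_to a u (p u))
  by (intros u hu; now apply is_pseries_sums_to, hser).
assert (hn0 : (0 < n)%nat) by lia.
destruct (power_series_order a p n hn0 hsum ha) as [M hord]; rewrite ea0 in hord.
assert (hjet : forall k z, Cmod z < 1 -> jet k p z)
  by (intros k z hz; now apply (power_series_jet k a p hsum)).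
pose proof PI_RGT_0 as hpi.
set (t := PI / 2 * mu) in *.
(* mu < 1 keeps the closed sector, except its vertex, in the open right half-plane. *)
assert (ht : 0 < t < PI / 2) by (unfold t; nra).
set (T := tan t).
assert (hT : 0 < T) by (apply tan_gt_0; lra).
set (gap := fun w : C => T * Re w - Rabs (Im w)).
assert (hgap : forall z d, Cmod z < 1 -> 0 < d ->
  near z (fun u => Rabs (gap (p u) - gap (p z)) < d)).
{ intros z d hz hd.
  assert (hc : cont_at p z) by (apply jet_cont; auto).
  apply near_imp with (2 := hc (d / (T + 1)) ltac:(apply Rdiv_lt_0_compat; lra)).
  intros u hu; eapply Rle_lt_trans; [apply sector_gap_lip; lra|].
  apply (Rmult_lt_compat_l (T + 1)) in hu; [|lra].
  replace ((T + 1) * (d / (T + 1))) with d in hu by (field; lra); exact hu. }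
assert (hgood : forall w, 0 < gap w -> 0 < Re w /\ Rabs (atan (Im w / Re w)) < t).
{ intros w hw; apply atan_lt_of_sector; [exact ht|unfold gap, T in hw; lra]. }
assert (main : forall z, Cmod z < 1 -> 0 < gap (p z)).
{ intros z1 hz1; apply Rnot_le_lt; intros hbad.
  destruct (min_modulus_point 1 (fun z => gap (p z) <= 0) z1) as [z0 [hz0 [hb0 hmin]]];
    [|exact hz1|exact hbad|].
  { intros z hz hg; apply Rnot_le_lt in hg.
    apply near_imp with (2 := hgap z _ hz hg).
    intros u hu; apply Rabs_lt_between in hu; lra. }
  assert (hin : forall z, Cmod z < Cmod z0 -> 0 < Re (p z) /\ Rabs (atan (Im (p z) / Re (p z))) < t)
    by (intros z hz; apply hgood, Rnot_le_lt, hmin, hz).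
  pose proof (order_bound_at_0 p a0 M n hn0 hord) as hp00.
  assert (hz0n : z0 <> RtoC 0).
  { intros ->; rewrite hp00 in hb0; unfold gap in hb0; simpl in hb0.
    rewrite Rabs_R0 in hb0; nra. }
  assert (hzp : 0 < Cmod z0) by now apply Cmod_gt_0.
  (* A negative gap would persist at (1 - r) z0 for small r > 0, a bad point of smaller modulus. *)
  assert (hgap0 : gap (p z0) = 0).
  { apply Rle_antisym; [exact hb0|]; apply Rnot_lt_le; intros hneg.
    destruct (hgap z0 (- gap (p z0)) hz0 ltac:(lra)) as [d [hd h]].
    set (r := Rmin (d / 2) (Cmod z0 / 2) / Cmod z0).
    assert (hr0 : 0 < Rmin (d / 2) (Cmod z0 / 2)) by (apply Rmin_pos; lra).
    assert (hr : 0 < r) by (apply Rdiv_lt_0_compat; lra).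
    assert (hrz : r * Cmod z0 = Rmin (d / 2) (Cmod z0 / 2)) by (unfold r; field; lra).
    pose proof (Rmin_l (d / 2) (Cmod z0 / 2)); pose proof (Rmin_r (d / 2) (Cmod z0 / 2)).
    assert (hr1 : r < 1) by nra.
    specialize (h (RtoC (1 - r) * z0)%C).
    replace (RtoC (1 - r) * z0 - z0)%C with (RtoC (- r) * z0)%C in h
      by (unfold RtoC, Cmult, Cminus, Cplus, Copp; simpl; f_equal; ring).
    rewrite Cmod_mult, Cmod_R, Rabs_Ropp, Rabs_pos_eq in h by lra.
    specialize (h ltac:(lra)); apply Rabs_lt_between in h.
    apply (hmin (RtoC (1 - r) * z0)%C); [|lra].
    rewrite Cmod_mult, Cmod_R, Rabs_pos_eq by lra; nra. }
  (* On the boundary of the sector Re = 0 only at the vertex, which p never attains. *)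
  assert (hre : 0 < Re (p z0)).
  { unfold gap in hgap0; pose proof (Rabs_pos (Im (p z0))) as hi.
    destruct (Req_dec (Re (p z0)) 0) as [h|h]; [exfalso|nra].
    rewrite h in hgap0.
    assert (hi0 : Im (p z0) = 0) by (apply NNPP; intros q; apply Rabs_pos_lt in q; lra).
    apply (hp0 z0 hz0); rewrite (surjective_pairing (p z0)).
    unfold Re, Im in h, hi0; now rewrite h, hi0. }
  assert (htouch : exists s, s * s = 1 /\ s * atan (Im (p z0) / Re (p z0)) = t).
  { unfold gap in hgap0; unfold Rabs in hgap0; destruct (Rcase_abs (Im (p z0))).
    - exists (-1); split; [ring|].
      replace (Im (p z0) / Re (p z0)) with (- T).
      + rewrite atan_opp; unfold T; rewrite atan_tan; lra.
      + apply Rmult_eq_reg_r with (Re (p z0)); [field_simplify; lra|lra].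
    - exists 1; split; [ring|].
      replace (Im (p z0) / Re (p z0)) with T.
      + unfold T; rewrite atan_tan; lra.
      + apply Rmult_eq_reg_r with (Re (p z0)); [field_simplify; lra|lra]. }
  destruct htouch as [s [hs htouch]].
  destruct (nunokawa p n a0 mu M s z0) as [b [hb hsb]]; auto.
  { intros z hz; apply hjet; lra. }
  destruct (harg z0 hz0) as [_ hlt].
  (* p - z p' = p (1 - z p' / p), and z p' / p = i b at z0. *)
  replace (p z0 - z0 * C_derive p z0)%C with (p z0 * (1, (- b)%R))%C in hlt.
  2: { replace (z0 * C_derive p z0)%C with (p z0 * (z0 * C_derive p z0 / p z0))%C
         by (field; apply hp0; exact hz0).
       rewrite hb; replace (1, (- b)%R) with (1 - (0, b))%C; [ring|].
       unfold Cminus, Cplus, Copp, RtoC; simpl; f_equal; ring. }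
  rewrite (proj2 (Carg_rotated (p z0) b hre)) in hlt.
  assert (hat : atan (INR n * mu) <= s * atan b).
  { assert (h : s = 1 \/ s = -1) by (assert (q : (s - 1) * (s + 1) = 0) by lra;
      apply Rmult_integral in q; lra).
    assert (h' : atan (s * b) = s * atan b).
    { destruct h as [->| ->]; [now rewrite !Rmult_1_l|].
      replace (-1 * b) with (- b) by ring; rewrite atan_opp; ring. }
    rewrite <- h'; destruct (Rle_lt_or_eq_dec _ _ hsb) as [q|q];
      [left; now apply atan_increasing|rewrite q; lra]. }
  assert (hs1 : Rabs s = 1) by (destruct (Rcase_abs s);
    [rewrite Rabs_left|rewrite Rabs_right]; nra).
  (* Multiplying by s merges the two sides of the sector; s atan b - t is then at least atan (n mu)
     - t, against the strict bound [hlt]. *)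
  assert (he : Rabs (atan (Im (p z0) / Re (p z0)) - atan b) = Rabs (t - s * atan b)).
  { rewrite <- htouch, <- Rmult_minus_distr_l, Rabs_mult, hs1; ring. }
  rewrite he in hlt; apply Rabs_lt_between in hlt; lra. }
intros z hz; split; [now apply hp0|].
destruct (hgood _ (main z hz)) as [h1 h2]; now rewrite Carg_atan.
Qed.
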